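(* The class of quasi-infinitely divisible distributions on $\mathbb R$ with finite quasi-Lévy measure and zero Gaussian variance is dense in the class of probability distributions on $\mathbb R$ with respect to weak convergence.
   Context: A representation function is a bounded Borel measurable function $c:\mathbb R\to\mathbb R$ with $\lim_{x\to0}(c(x)-x)/x^2=0$. Put $g_c(x,z)=(\mathrm e^{\mathrm i zx}-1-\mathrm i zc(x))/(1\wedge x^2)$ for $x\ne0$ and $g_c(0,z)=-z^2/2$. A probability distribution $\mu$ on $\mathbb R$ is quasi-infinitely divisible if, for a fixed representation function $c$, there are $\gamma\in\mathbb R$ and a finite signed Borel measure $\zeta$ on $\mathbb R$ with $\widehat\mu(z)=\int\mathrm e^{\mathrm i zx}\mu(\mathrm dx)=\exp(\mathrm i\gamma z+\int_{\mathbb R}g_c(x,z)\,\zeta(\mathrm dx))$ for all $z\in\mathbb R$. (This property does not depend on $c$; for given $c$ the pair $(\zeta,\gamma)$ is unique, and $\zeta$ does not depend on $c$.) The Gaussian variance of $\mu$ is $a=\zeta(\{0\})$. The quasi-Lévy measure of $\mu$ is the function $\nu(B)=\int_B(1\wedge x^2)^{-1}\zeta(\mathrm dx)$ on Borel sets $B$ bounded away from $0$. For every $r>0$ its restriction to Borel subsets of $\mathbb R\setminus(-r,r)$ is a finite signed measure; $|\nu|$ is the measure on $\mathbb R$ with $|\nu|(\{0\})=0$ that coincides on these subsets with the total variation of the restriction, for each $r>0$. The quasi-Lévy measure is finite if $|\nu|(\mathbb R)<\infty$. Weak convergence of probability measures is convergence of integrals of all bounded continuous functions. *)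

(* Defs.v *)
From HB Require Import structures.
From mathcomp Require Import all_boot all_order all_algebra.
From mathcomp Require Import complex.
From mathcomp Require Import all_classical all_reals all_analysis.
From mathcomp Require Import measurable_realfun.

Set Implicit Arguments.
Unset Strict Implicit.
Unset Printing Implicit Defensive.

Import Order.TTheory GRing.Theory Num.Theory.
Import numFieldNormedType.Exports.

Local Open Scope classical_set_scope.
Local Open Scope ring_scope.

(* Integration against a charge (finite signed measure), through its Jordan
   decomposition. The Hahn decomposition is chosen, but on measurable sets
   [charge_pos], [charge_neg] and [charge_total_variation] do not depend on it
   ([Hahn_decomposition_uniq]). *)
Section charge_integral.
Context d (T : measurableType d) (R : realType).
Variable zeta : {charge set T -> \bar R}.

Definition hahn_pos : set T := projT1 (cid (Hahn_decomposition zeta)).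

Definition hahn_neg : set T :=
  projT1 (cid (projT2 (cid (Hahn_decomposition zeta)))).

Lemma hahn_posneg : hahn_decomposition zeta hahn_pos hahn_neg.
Proof. exact: projT2 (cid (projT2 (cid (Hahn_decomposition zeta)))). Qed.

Definition charge_pos : {finite_measure set T -> \bar R} :=
  jordan_pos hahn_posneg.

Definition charge_neg : {finite_measure set T -> \bar R} :=
  jordan_neg hahn_posneg.

Definition charge_total_variation : {measure set T -> \bar R} :=
  charge_variation hahn_posneg.

Definition charge_integral (D : set T) (f : T -> \bar R) : \bar R :=
  (\int[charge_pos]_(x in D) f x - \int[charge_neg]_(x in D) f x)%E.

Definition charge_Cintegral (f : T -> R[i]) : R[i] :=
  Complex (fine (charge_integral setT (fun x => (complex.Re (f x))%:E)))
          (fine (charge_integral setT (fun x => (complex.Im (f x))%:E))).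

End charge_integral.

Definition Cintegral d (T : measurableType d) (R : realType)
    (mu : {measure set T -> \bar R}) (f : T -> R[i]) : R[i] :=
  Complex (\int[mu]_x complex.Re (f x))%R (\int[mu]_x complex.Im (f x))%R.

Definition Cexp (R : realType) (w : R[i]) : R[i] :=
  real_complex R (expR (complex.Re w))
  * Complex (cos (complex.Im w)) (sin (complex.Im w)).

Section quasi_infinitely_divisible.
Variable R : realType.
Local Notation "x %:C" := (real_complex R x).
Local Notation "''i'" := (Complex (0 : R) (1 : R)).

Definition representation_function (c : R -> R) : Prop :=
  [/\ bounded_fun c,
      measurable_fun setT c &
      (c x - x) / x ^+ 2 @[x --> (0 : R)^'] --> (0 : R)].

Definition g_ (c : R -> R) (x z : R) : R[i] :=
  if x == 0 then (- (z ^+ 2 / 2))%:C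
  else (Cexp ('i * (z * x)%:C) - 1 - 'i * (z * c x)%:C)
       / (Num.min 1 (x ^+ 2))%:C.

Definition characteristic_function (mu : probability R R) (z : R) : R[i] :=
  Cintegral mu (fun x => Cexp ('i * (z * x)%:C)).

Definition characteristic_pair (c : R -> R) (mu : probability R R)
    (zeta : {charge set R -> \bar R}) (gamma : R) : Prop :=
  forall z : R, characteristic_function mu z =
    Cexp ('i * (gamma * z)%:C + charge_Cintegral zeta (fun x => g_ c x z)).

Definition gaussian_variance (zeta : {charge set R -> \bar R}) : \bar R :=
  zeta [set (0 : R)].

(* Meaningful only on Borel sets bounded away from 0. *)
Definition quasi_levy (zeta : {charge set R -> \bar R}) (B : set R)
    : \bar R :=
  charge_integral zeta B (fun x => ((Num.min 1 (x ^+ 2))^-1)%:E).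

Definition away (r : R) : set R := ~` [set` `]- r, r[].

(* The restriction of the quasi-Levy measure to the complement of ]-r, r[,
   extended by 0 to a charge on the line. *)
Definition quasi_levy_restr (zeta : {charge set R -> \bar R})
    (r : {posnum R}) (B : set R) : \bar R :=
  quasi_levy zeta (B `&` away r%:num).

Section quasi_levy_restr_charge.
Variables (zeta : {charge set R -> \bar R}) (r : {posnum R}).

Let w (x : R) : R := (Num.min 1 (x ^+ 2))^-1.

Let measurable_away : measurable (away r%:num).
Proof. by apply: measurableC; exact: measurable_itv. Qed.

Let w_gt0 (x : R) : x != 0 -> 0 < Num.min 1 (x ^+ 2) :> R.
Proof. by move=> x0; rewrite lt_min ltr01 exprn_even_gt0. Qed.

Let away_neq0 (x : R) : away r%:num x -> r%:num <= `|x|.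
Proof. by rewrite /away /= in_itv /= => /negP; rewrite -ltr_norml -leNgt. Qed.

Let measurable_w : measurable_fun (away r%:num) w.
Proof.
pose D : set R := [set x | x != 0].
have oD : open D.
  rewrite (_ : D = ~` [set 0]); first exact: closed_openC.
  by apply/seteqP; split => x /= /eqP.
apply: (@measurable_funS _ _ _ _ D).
- exact: open_measurable.
- move=> x /away_neq0 rx; rewrite /D /= -normr_gt0.
  exact: lt_le_trans rx.
- apply: (@open_continuous_measurable_fun R D w oD) => x; rewrite inE /D /=.
  move=> x0; apply: cvgV; first by rewrite gt_eqF// w_gt0.
  apply: (@continuous_min R R (fun=> 1) (fun y : R => y ^+ 2) x).
    exact: cvg_cst.
  exact: exprn_continuous.
Qed.

Let integrable_w (mu : {finite_measure set R -> \bar R}) :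
  mu.-integrable setT ((fun x => (w x)%:E) \_ (away r%:num)).
Proof.
apply/(integrable_mkcond _ measurable_away).
apply: measurable_bounded_integrable => //.
  by rewrite -ge0_fin_numE// fin_num_measure.
exists ((Num.min 1 (r%:num ^+ 2))^-1); split; first exact: num_real.
move=> y ry x /away_neq0 rx; apply: le_trans (ltW ry).
have x0 : x != 0 by rewrite -normr_gt0; exact: lt_le_trans rx.
rewrite /w ger0_norm ?invr_ge0 ?(ltW (w_gt0 x0))//.
rewrite lef_pV2 ?posrE ?w_gt0// ?lt_min ?ltr01 ?exprn_even_gt0//.
rewrite le_min ge_min lexx/= ge_min -(real_normK (num_real x)).
by rewrite lerXn2r ?nnegrE ?orbT.
Qed.

Let quasi_levy_restrE : quasi_levy_restr zeta r =
  cadd (induced_charge (integrable_w (charge_pos zeta)))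
       (cscale (-1) (induced_charge (integrable_w (charge_neg zeta)))).
Proof.
apply/funext => B; rewrite /cadd /= /cscale /= EFinN mulN1e.
by rewrite /quasi_levy_restr /quasi_levy /charge_integral !integral_mkcondr.
Qed.

Let quasi_levy_restr0 : quasi_levy_restr zeta r set0 = 0%E.
Proof. by rewrite quasi_levy_restrE charge0. Qed.

Let quasi_levy_restr_fin : fin_num_fun (quasi_levy_restr zeta r).
Proof. by move=> B mB; rewrite quasi_levy_restrE fin_num_measure. Qed.

Let quasi_levy_restr_sigma_additive :
  semi_sigma_additive (quasi_levy_restr zeta r).
Proof. by rewrite quasi_levy_restrE; exact: charge_semi_sigma_additive. Qed.

HB.instance Definition _ := isCharge.Build _ _ _ (quasi_levy_restr zeta r)
  quasi_levy_restr0 quasi_levy_restr_fin quasi_levy_restr_sigma_additive.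

End quasi_levy_restr_charge.

(* [m] is the measure |nu|. *)
Definition is_quasi_levy_variation (zeta : {charge set R -> \bar R})
    (m : {measure set R -> \bar R}) : Prop :=
  m [set (0 : R)] = 0%E /\
  forall (r : {posnum R}) (B : set R), measurable B -> B `<=` away r%:num ->
    m B = charge_total_variation (quasi_levy_restr zeta r) B.

Definition finite_quasi_levy (zeta : {charge set R -> \bar R}) : Prop :=
  exists m : {measure set R -> \bar R},
    is_quasi_levy_variation zeta m /\ (m setT < +oo)%E.

(* Quasi-infinitely divisible distributions with finite quasi-Levy measure and
   zero Gaussian variance, with characteristic pairs relative to [c]. *)
Definition qid_finite_no_gauss (c : R -> R) : set (probability R R) :=
  [set mu | exists (zeta : {charge set R -> \bar R}) (gamma : R),
    [/\ characteristic_pair c mu zeta gamma,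
        finite_quasi_levy zeta &
        gaussian_variance zeta = 0%E]].

Definition weak_cvg (mu_ : nat -> probability R R) (mu : probability R R)
    : Prop :=
  forall f : R -> R, continuous f -> bounded_fun f ->
    (\int[mu_ n]_x f x)%R @[n --> \oo] --> (\int[mu]_x f x)%R.

(* Sequential density; weak convergence of probability measures on the line is
   metrizable. *)
Definition weakly_dense (A : set (probability R R)) : Prop :=
  forall mu : probability R R,
    exists2 mu_ : nat -> probability R R,
      (forall n, A (mu_ n)) & weak_cvg mu_ mu.

End quasi_infinitely_divisible.

(* Main.v *)
Require Import Defs.
From HB Require Import structures.
From mathcomp Require Import all_boot all_order all_algebra.
From mathcomp Require Import complex.
From mathcomp Require Import all_classical all_reals all_analysis.
From mathcomp Require Import measurable_realfun.
From mathcomp Require Import ring lra.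

Set Implicit Arguments.
Unset Strict Implicit.
Unset Printing Implicit Defensive.

Import Order.TTheory GRing.Theory Num.Theory.
Import numFieldNormedType.Exports.
Import Normc.

Local Open Scope classical_set_scope.
Local Open Scope ring_scope.

(** Let [q] be a polynomial with nonnegative coefficients and [q.[1] = 1].  The
distribution that puts the mass [q`_k] at the lattice point [k * h - a] has the
characteristic function [expi (- a * t) * q.[w]] with [w = expi (h * t)].
Suppose that [q] has no zero on the unit circle, and factor it over the complex
numbers.  A root [z] outside the unit disk contributes, up to a constant,
[1 - z^-1 * w], and a root inside contributes [w * (1 - z * w^-1)].  By the
logarithmic series [1 - u = exp (- sum_k u ^ k / k)], valid for [|u| < 1], the
characteristic function becomes
  [expi (gamma * t) * exp (sum_k b_k (expi (x_k * t) - 1))]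
with [sum_k |b_k|] finite.  The [b_k] are real since the nonreal roots come in
conjugate pairs.  Hence the signed measure with mass [b_k] at [x_k] is a finite
quasi-Levy measure, and there is no Gaussian part
([signed_compound_poisson_horner], [qid_signed_compound_poisson]).

It remains to see that the lattice distributions of this kind are dense.
Rounding to a grid whose mesh tends to 0 and whose range tends to the whole
line approximates a given distribution by lattice distributions, with
polynomials [p] that may vanish somewhere on the circle.  For [r > 0] the
polynomial [p (r X) / p (r)] still has nonnegative coefficients that add up to
1, and its roots are those of [p] divided by [r].  So it has no zero on the
circle unless [r] is the modulus of one of the finitely many roots of [p], and
[r] can be taken as close to 1 as desired ([poly_perturbation],
[lattice_approximation]). *)

(** * Complex series and the logarithm of [1 - z] *)

Section complex_series.
Variable R : realType.
Implicit Types (z w : R[i]) (u v : nat -> R[i]).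

Lemma cReD z w : complex.Re (z + w) = complex.Re z + complex.Re w.
Proof. by case: z w => [a b] [c d]. Qed.

Lemma cImD z w : complex.Im (z + w) = complex.Im z + complex.Im w.
Proof. by case: z w => [a b] [c d]. Qed.

Lemma cReM z w : complex.Re (z * w) =
  complex.Re z * complex.Re w - complex.Im z * complex.Im w.
Proof. by case: z w => [a b] [c d]. Qed.

Lemma cImM z w : complex.Im (z * w) =
  complex.Re z * complex.Im w + complex.Im z * complex.Re w.
Proof. by case: z w => [a b] [c d]. Qed.

Lemma Re_le_normc z : `|complex.Re z| <= normc z.
Proof.
case: z => a b /=; rewrite -sqrtr_sqr ler_wsqrtr// lerDl; exact: sqr_ge0.
Qed.

Lemma Im_le_normc z : `|complex.Im z| <= normc z.
Proof.
case: z => a b /=; rewrite -sqrtr_sqr ler_wsqrtr// lerDr; exact: sqr_ge0.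
Qed.

Lemma normc_ge0 z : 0 <= normc z.
Proof. exact: le_trans (normr_ge0 _) (Re_le_normc z). Qed.

Lemma normcX z n : normc (z ^+ n) = normc z ^+ n.
Proof. by elim: n => [|n ih]; rewrite ?expr0 ?normc1// !exprS normcM ih. Qed.

Lemma normc_real (x : R) : normc (real_complex R x) = `|x|.
Proof. by rewrite /= expr0n/= addr0 sqrtr_sqr. Qed.

Lemma normc_sum (I : Type) (s : seq I) (F : I -> R[i]) :
  normc (\sum_(i <- s) F i) <= \sum_(i <- s) normc (F i).
Proof.
elim: s => [|x s ih]; first by rewrite !big_nil normc0.
by rewrite !big_cons (le_trans (le_normcD _ _))// lerD2l.
Qed.

Definition csummable u := cvgn (series (fun k => normc (u k))).

Definition csum u : R[i] :=
  Complex (limn (series (fun k => complex.Re (u k))))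
          (limn (series (fun k => complex.Im (u k)))).

Lemma cvg_series_dominated (f g : nat -> R) : (forall k, `|f k| <= g k) ->
  cvgn (series g) -> cvgn (series f).
Proof.
move=> fg cg; apply: normed_cvg; apply: (@series_le_cvg _ _ g) => //= k.
by rewrite (le_trans _ (fg k)).
Qed.

Lemma csummable_Re u : csummable u ->
  cvgn (series (fun k => complex.Re (u k))).
Proof. by apply: cvg_series_dominated => k; exact: Re_le_normc. Qed.

Lemma csummable_Im u : csummable u ->
  cvgn (series (fun k => complex.Im (u k))).
Proof. by apply: cvg_series_dominated => k; exact: Im_le_normc. Qed.

Lemma csummable_dominated u (g : nat -> R) : (forall k, normc (u k) <= g k) ->
  cvgn (series g) -> csummable u.
Proof.
move=> ug; apply: cvg_series_dominated => k; rewrite ger0_norm//.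
exact: normc_ge0.
Qed.

Lemma csummableD u v : csummable u -> csummable v ->
  csummable (fun k => u k + v k).
Proof.
move=> su sv; apply: (@csummable_dominated _ (fun k => normc (u k) + normc (v k))).
  by move=> k; exact: le_normcD.
exact: (@is_cvg_seriesD R (fun k => normc (u k)) (fun k => normc (v k))).
Qed.

Lemma csummableZ z u : csummable u -> csummable (fun k => z * u k).
Proof.
move=> su; rewrite /csummable.
under eq_fun do rewrite normcM.
exact: (@is_cvg_seriesZ R (fun k => normc (u k)) (normc z)).
Qed.

Lemma csumD u v : csummable u -> csummable v ->
  csum (fun k => u k + v k) = csum u + csum v.
Proof.
move=> su sv; rewrite /csum.
under eq_fun do rewrite cReD.
under [X in Complex _ (limn (series X))]eq_fun do rewrite cImD.
congr Complex.
  by apply: (@lim_seriesD R); exact: csummable_Re.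
by apply: (@lim_seriesD R); exact: csummable_Im.
Qed.

Lemma csumZ z u : csummable u -> csum (fun k => z * u k) = z * csum u.
Proof.
move=> su; have cR := csummable_Re su; have cI := csummable_Im su.
rewrite /csum; case: z => a b.
under eq_fun do rewrite cReM/=.
under [X in Complex _ (limn (series X))]eq_fun do rewrite cImM/=.
congr Complex.
- rewrite (@lim_seriesB R (fun k => a * complex.Re (u k))
    (fun k => b * complex.Im (u k))); last 2 first.
    exact: (@is_cvg_seriesZ R _ a).
    exact: (@is_cvg_seriesZ R _ b).
  by congr (_ - _); apply: (@lim_seriesZ R).
- rewrite (@lim_seriesD R (fun k => a * complex.Im (u k))
    (fun k => b * complex.Re (u k))); last 2 first.
    exact: (@is_cvg_seriesZ R _ a).
    exact: (@is_cvg_seriesZ R _ b).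
  by congr (_ + _); apply: (@lim_seriesZ R).
Qed.

Lemma csum_big (I : eqType) (s : seq I) (F : I -> nat -> R[i]) :
  {in s, forall i, csummable (F i)} ->
  csummable (fun k => \sum_(i <- s) F i k) /\
  csum (fun k => \sum_(i <- s) F i k) = \sum_(i <- s) csum (F i).
Proof.
elim: s => [_|x s ih sF].
  under eq_fun do rewrite big_nil.
  split.
    apply: (@csummable_dominated _ (fun=> 0)); first by move=> k; rewrite normc0.
    by rewrite /series/=; under eq_fun do rewrite big1//; exact: is_cvg_cst.
  rewrite big_nil /csum/= /series/=.
  by under eq_fun do rewrite big1//; rewrite lim_cst.
have [|ih1 ih2] := ih; first by move=> y ys; apply: sF; rewrite inE ys orbT.
have sx : csummable (F x) by apply: sF; rewrite inE eqxx.
under eq_fun do rewrite big_cons.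
by split; [exact: csummableD|rewrite csumD// ih2 big_cons].
Qed.

Lemma csum_recl u : csummable u ->
  csum u = u 0%N + csum (fun k => u k.+1).
Proof.
move=> su.
have aux (f : nat -> R) : cvgn (series f) ->
    limn (series f) = f 0%N + limn (series (fun k => f k.+1)).
  move=> cf; apply/cvg_lim => //; rewrite -cvg_shiftS.
  under eq_fun do rewrite /series/= big_nat_recl//.
  apply: cvgD; first exact: cvg_cst.
  have cf' : cvgn (series (fun k => f k.+1)).
    have : cvgn (fun n => series f n.+1).
      by apply/cvg_ex; exists (limn (series f)); rewrite cvg_shiftS.
    under eq_fun do rewrite /series/= big_nat_recl//.
    by rewrite is_cvgDrE//; exact: is_cvg_cst.
  exact: cf'.
rewrite /csum (aux _ (csummable_Re su)) (aux _ (csummable_Im su)).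
by case: (u 0%N).
Qed.

Lemma csummable_geometric z : normc z < 1 -> csummable (fun k => z ^+ k).
Proof.
move=> z1; rewrite /csummable; under eq_fun do rewrite normcX.
have -> : (fun k => normc z ^+ k) = geometric 1 (normc z).
  by apply/funext => k /=; rewrite mul1r.
by apply: is_cvg_geometric_series; rewrite ger0_norm// normc_ge0.
Qed.

(** With [t = sqrt s], the average of [1, t, .., t ^ k] is at least [t ^ k], so
[k.+1 * t ^ k] is at most the sum of the geometric series of ratio [t], and
[k.+1 * s ^ k] is at most a constant times [t ^ k]. *)
Lemma cvg_series_arith_geometric (s : R) : 0 <= s < 1 ->
  cvgn (series (fun k => k.+1%:R * s ^+ k)).
Proof.
move=> /andP[s0 s1]; pose t := Num.sqrt s.
have t0 : 0 <= t by exact: sqrtr_ge0.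
have t1 : t < 1 by rewrite -sqrtr1 ltr_sqrt.
have st : s = t ^+ 2 by rewrite sqr_sqrtr.
apply: (@cvg_series_dominated _ (geometric ((1 - t)^-1) t)); last first.
  by apply: is_cvg_geometric_series; rewrite ger0_norm.
move=> k; rewrite ger0_norm/=; last by rewrite mulr_ge0// exprn_ge0.
rewrite st -exprM mul2n -addnn exprD mulrA ler_wpM2r ?exprn_ge0//.
rewrite -[leRHS]mul1r ler_pdivlMr ?subr_gt0//.
apply: (@le_trans _ _ ((1 - t) * \sum_(i < k.+1) t ^+ i)).
  rewrite mulrC ler_wpM2l ?subr_ge0 ?(ltW t1)//.
  rewrite mulr_natl (_ : _ *+ _ = \sum_(i < k.+1) t ^+ k); last first.
    by rewrite sumr_const card_ord.
  apply: ler_sum => i _.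
  by rewrite ler_wiXn2l// ?(ltW t1)// -ltnS.
by rewrite -opprB mulNr -subrX1 opprB gerBl exprn_ge0.
Qed.

(** The sum is indexed from 0, where the inverse of 0 makes the term vanish. *)
Definition neg_log1m z : R[i] := csum (fun k => z ^+ k / k%:R).

Lemma normc_natV (k : nat) : normc ((k%:R)^-1 : R[i]) = (k%:R)^-1.
Proof.
rewrite normcV; congr (_^-1).
rewrite (_ : k%:R = real_complex R k%:R); last by rewrite rmorph_nat.
by rewrite normc_real normr_nat.
Qed.

Lemma csummable_neg_log1m z : normc z < 1 -> csummable (fun k => z ^+ k / k%:R).
Proof.
move=> z1; apply: (@csummable_dominated _ (fun k => normc (z ^+ k))); last first.
  exact: csummable_geometric.
move=> [|k]; first by rewrite invr0 mulr0 normc0 normc_ge0.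
by rewrite normcM normc_natV ler_piMr ?normc_ge0// invf_le1// ler1n.
Qed.

Lemma CexpD z w : Cexp (z + w) = Cexp z * Cexp w.
Proof.
rewrite /Cexp; case: z w => [a b] [c d]; apply/eqP; rewrite eq_complex/=.
by rewrite expRD cosD sinD; apply/andP; split; apply/eqP; ring.
Qed.

Lemma Cexp0 : Cexp (0 : R[i]) = 1.
Proof.
by rewrite /Cexp/= expR0 cos0 sin0 mulr1.
Qed.

Lemma CexpN z : Cexp z * Cexp (- z) = 1.
Proof. by rewrite -CexpD subrr Cexp0. Qed.

Lemma Cexp_sum (I : Type) (s : seq I) (F : I -> R[i]) :
  Cexp (\sum_(i <- s) F i) = \prod_(i <- s) Cexp (F i).
Proof. by apply: (big_morph _ CexpD Cexp0). Qed.

(** The series [L t] of [(t * u) ^ k / k] satisfies [L' t * (1 - t * u) = u], so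
that [exp (L t) * (1 - t * u)] has derivative 0 and keeps on [0, 1] its value 1
at 0.  This is carried out on real and imaginary parts: [a] and [b] are those of
[L], and [U] and [V] those of [exp (L t) * (1 - t * u)]. *)
Section log.
Variables (u : R[i]) (u1 : normc u < 1).
Let p := complex.Re u.
Let q := complex.Im u.
Let r k := complex.Re (u ^+ k).
Let i k := complex.Im (u ^+ k).
Let A := pseries (fun k => r k / k%:R).
Let B := pseries (fun k => i k / k%:R).

Let cvg_pseries_bound (f : nat -> R) (K : R) : 0 <= K -> normc u * K < 1 ->
  (forall k, `|f k| <= k.+1%:R * normc u ^+ k) -> cvgn (pseries f K).
Proof.
move=> K0 uK fu.
apply: (@cvg_series_dominated _ (fun k => k.+1%:R * (normc u * K) ^+ k)).
  move=> k; rewrite normrM normrX (ger0_norm K0) exprMn mulrA.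
  by rewrite ler_wpM2r ?exprn_ge0.
by apply: cvg_series_arith_geometric; rewrite uK mulr_ge0// normc_ge0.
Qed.

Let derive_part (f : nat -> R) (t : R) : (forall k, `|f k| <= normc u ^+ k) ->
  0 <= t <= 1 ->
  is_derive t (1 : R) (fun x => limn (pseries (fun k => f k / k%:R) x))
    (limn (pseries (fun k => f k.+1) t)).
Proof.
move=> fu /andP[t0 t1].
have u0 := normc_ge0 u.
(* Termwise differentiation needs a point of convergence beyond [0, 1]: any
   [K > 1] with [normc u * K < 1] will do. *)
pose K : R := 2 / (1 + normc u).
have v1 : 0 < 1 + normc u by rewrite ltr_wpDr.
have K1 : 1 < K by rewrite /K ltr_pdivlMr// mul1r -[2]/(1 + 1) ltrD2l.
have uK : normc u * K < 1.
  rewrite /K mulrA ltr_pdivrMr// mul1r mulr_natr mulr2n.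
  by rewrite ltrD2r.
have K0 : 0 <= K by exact: le_trans ler01 (ltW K1).
have diffsE : pseries_diffs (fun k => f k / k%:R) = (fun k => f k.+1).
  by apply/funext => k; rewrite /pseries_diffs mulrC divfK// pnatr_eq0.
have fu' k : `|f k.+1| <= normc u ^+ k.
  apply: (le_trans (fu _)); rewrite exprS ler_piMl ?exprn_ge0// ltW//.
rewrite -diffsE; apply: (@pseries_snd_diffs _ _ K).
- apply: cvg_pseries_bound => // k.
  case: k => [|k]; first by rewrite invr0 mulr0 normr0 mul1r exprn_ge0.
  rewrite normrM normfV normr_nat.
  apply: (@le_trans _ _ `|f k.+1|).
    by rewrite ler_piMr// invf_le1// ler1n.
  apply: (le_trans (fu _)); rewrite ler_peMl ?exprn_ge0// ler1n//.
- rewrite diffsE; apply: cvg_pseries_bound => // k.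
  by apply: (le_trans (fu' _)); rewrite ler_peMl ?exprn_ge0// ler1n.
- rewrite diffsE /pseries_diffs; apply: cvg_pseries_bound => // k.
  rewrite normrM normr_nat ler_wpM2l//.
  by apply: (le_trans (fu' _)); rewrite exprS ler_piMl ?exprn_ge0// ltW.
- by rewrite ger0_norm// ger0_norm// (le_lt_trans t1).
Qed.

Let Re_exp_le k : `|complex.Re (u ^+ k)| <= normc u ^+ k.
Proof. by rewrite -normcX Re_le_normc. Qed.

Let Im_exp_le k : `|complex.Im (u ^+ k)| <= normc u ^+ k.
Proof. by rewrite -normcX Im_le_normc. Qed.

Let a (t : R) := limn (A t).
Let b (t : R) := limn (B t).

Let derive_ab (t : R) : 0 <= t <= 1 -> exists D : R[i],
  [/\ D * (1 - u * real_complex R t) = u,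
      is_derive t (1 : R) a (complex.Re D) &
      is_derive t (1 : R) b (complex.Im D)].
Proof.
move=> /[dup] t01 /andP[t0 t1].
pose tu := u * real_complex R t.
have tu1 : normc tu < 1.
  rewrite /tu normcM normc_real ger0_norm// (le_lt_trans _ u1)//.
  by rewrite ler_piMr// normc_ge0.
have geo := csummable_geometric tu1.
have E k : u * tu ^+ k = u ^+ k.+1 * real_complex R (t ^+ k).
  by rewrite /tu exprMn mulrA -exprS rmorphXn.
exists (csum (fun k => u * tu ^+ k)); split.
- rewrite csumZ// -/tu mulrBr mulr1 {1}csum_recl// expr0.
  have -> : (fun k => tu ^+ k.+1) = (fun k => tu * tu ^+ k).
    by apply/funext => k; rewrite exprS.
  by rewrite csumZ//; ring.
- have := derive_part Re_exp_le t01.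
  congr is_derive; congr (limn (series _)); apply/funext => k.
  by rewrite E cReM/= mulr0 subr0.
- have := derive_part Im_exp_le t01.
  congr is_derive; congr (limn (series _)); apply/funext => k.
  by rewrite E cImM/= mulr0 add0r.
Qed.

Let U (t : R) :=
  expR (a t) * (cos (b t) * (1 - t * p) + sin (b t) * (t * q)).
Let V (t : R) :=
  expR (a t) * (sin (b t) * (1 - t * p) - cos (b t) * (t * q)).

Let derive_UV (t : R) : 0 <= t <= 1 ->
  is_derive t (1 : R) U 0 /\ is_derive t (1 : R) V 0.
Proof.
move=> /derive_ab[D [Du da db]].
have ReE : complex.Re D * (1 - t * p) + complex.Im D * (t * q) = p.
  rewrite [RHS](_ : _ = complex.Re u)// -[in RHS]Du /p /q.
  case: (u) (D) => [x y] [z w] /=; ring.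
have ImE : complex.Im D * (1 - t * p) - complex.Re D * (t * q) = q.
  rewrite [RHS](_ : _ = complex.Im u)// -[in RHS]Du /p /q.
  case: (u) (D) => [x y] [z w] /=; ring.
split.
- apply: is_derive_eq; rewrite /GRing.scale/=.
  transitivity (expR (a t) *
    (cos (b t) * (complex.Re D * (1 - t * p) + complex.Im D * (t * q) - p) -
     sin (b t) * (complex.Im D * (1 - t * p) - complex.Re D * (t * q) - q))).
    by ring.
  by rewrite ReE ImE; ring.
- apply: is_derive_eq; rewrite /GRing.scale/=.
  transitivity (expR (a t) *
    (sin (b t) * (complex.Re D * (1 - t * p) + complex.Im D * (t * q) - p) +
     cos (b t) * (complex.Im D * (1 - t * p) - complex.Re D * (t * q) - q))).
    by ring.
  by rewrite ReE ImE; ring.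
Qed.

Let const01 (F : R -> R) :
  (forall t : R, 0 <= t <= 1 -> is_derive t (1 : R) F 0) -> F 1 = F 0.
Proof.
move=> dF; apply/eqP; rewrite -subr_eq0; apply/eqP.
have [||x _ ->] := @MVT_segment R F (cst 0) 0 1 ler01.
- by move=> x; rewrite in_itv/= => /andP[x0 x1]; apply: dF; rewrite !ltW.
- apply: derivable_within_continuous => x; rewrite in_itv/= => x01.
  by have [] := dF _ x01.
- by rewrite mul0r.
Qed.

Let ab0 : a 0 = 0 /\ b 0 = 0.
Proof.
have aux (f : nat -> R) : limn (pseries (fun k => f k / k%:R) 0) = 0.
  rewrite /pseries (_ : [sequence _]_i = cst 0); last first.
    by apply/funext => -[|k] /=; rewrite ?invr0 ?mulr0 ?mul0r// expr0n mulr0.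
  by rewrite /series/=; under eq_fun do rewrite big1//; rewrite lim_cst.
by rewrite /a /b /A /B !aux.
Qed.

Lemma Cexp_neg_log1m : Cexp (- neg_log1m u) = 1 - u.
Proof.
have UV (t : R) := @derive_UV t.
have U1 := const01 (fun (t : R) t01 => (UV t t01).1).
have V1 := const01 (fun (t : R) t01 => (UV t t01).2).
move: U1 V1; rewrite /U /V; have [-> ->] := ab0.
rewrite cos0 sin0 expR0 !mul0r !mul1r !addr0 !subr0 => U1 V1.
have LE : neg_log1m u = Complex (a 1) (b 1).
  rewrite /neg_log1m /csum /a /b /A /B /pseries.
  have kV k : (k%:R)^-1 = real_complex R (k%:R)^-1.
    by rewrite fmorphV rmorph_nat.
  congr (Complex (limn (series _)) (limn (series _))); apply/funext => k /=.
    by rewrite kV cReM/= mulr0 subr0 expr1n mulr1.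
  by rewrite kV cImM/= mulr0 add0r expr1n mulr1.
have E1 : Cexp (neg_log1m u) * (1 - u) = 1.
  rewrite LE /Cexp/=; move: U1 V1; rewrite /p /q; case: (u) => x y /= U1 V1.
  apply/eqP; rewrite eq_complex/=; apply/andP; split; apply/eqP.
    by rewrite -[RHS]U1; ring.
  by rewrite -[RHS]V1; ring.
transitivity (Cexp (- neg_log1m u) * (Cexp (neg_log1m u) * (1 - u))).
  by rewrite E1 mulr1.
by rewrite mulrA [X in X * _]mulrC CexpN mul1r.
Qed.

End log.
End complex_series.

(** * Functions exp (i gamma t + sum_k b_k (exp (i x_k t) - 1)) *)
Section interleave.
Variable R : realType.

Definition interleave (T : Type) (u v : nat -> T) (k : nat) : T :=
  if odd k then v k./2 else u k./2.

Lemma series_interleave (f g : nat -> R) n :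
  series (interleave f g) n.*2 = series f n + series g n.
Proof.
elim: n => [|n ih]; first by rewrite /series/= !big_geq// addr0.
rewrite doubleS !seriesSr ih /interleave/= odd_double/= uphalf_double.
by rewrite doubleK; ring.
Qed.

(** Absolute convergence is what allows the limit to be read off along the even
partial sums, which are sums of partial sums of the two series. *)
Lemma cvg_series_interleave (f g : nat -> R) :
  cvgn (series (fun k => `|f k|)) -> cvgn (series (fun k => `|g k|)) ->
  cvgn (series (fun k => `|interleave f g k|)) /\
  limn (series (interleave f g)) = limn (series f) + limn (series g).
Proof.
move=> cf cg.
have E : (fun k => `|interleave f g k|) =
    interleave (fun k => `|f k|) (fun k => `|g k|).
  by apply/funext => k; rewrite /interleave; case: ifP.
have ndf (h : nat -> R) : nondecreasing_seq (series (fun k => `|h k|)).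
  by apply: nondecreasing_series => *.
have ch : cvgn (series (fun k => `|interleave f g k|)).
  apply: nondecreasing_is_cvgn => //.
  exists (limn (series (fun k => `|f k|)) + limn (series (fun k => `|g k|))).
  move=> _ [n _ <-].
  have := ndf (interleave f g) n n.*2; rewrite -addnn leq_addr => /(_ isT).
  rewrite addnn E series_interleave => /le_trans; apply.
  by apply: lerD; apply: nondecreasing_cvgn_le.
split => //; have {}ch := normed_cvg ch.
have c2 : (fun n => n.*2) @ \oo --> \oo.
  apply/cvgnyPge => N; exists N => // n /= Nn.
  by rewrite (leq_trans Nn)// -addnn leq_addr.
have : (series (interleave f g) \o double) @ \oo -->
    limn (series (interleave f g)).
  exact: cvg_comp c2 ch.
move/cvg_lim => <- //; rewrite -limD; [|exact: normed_cvg cf|exact: normed_cvg cg].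
congr (limn _); apply/funext => n /=; exact: series_interleave.
Qed.

Lemma csum_interleave (u v : nat -> R[i]) : csummable u -> csummable v ->
  csummable (interleave u v) /\ csum (interleave u v) = csum u + csum v.
Proof.
move=> su sv.
have absE (w : nat -> R[i]) : (fun k => normc (w k)) = (fun k => `|normc (w k)|).
  by apply/funext => k; rewrite ger0_norm// normc_ge0.
have E (f : R[i] -> R) : (fun k => f (interleave u v k)) =
    interleave (fun k => f (u k)) (fun k => f (v k)).
  by apply/funext => k; rewrite /interleave; case: ifP.
split.
  have := @cvg_series_interleave (fun k => normc (u k)) (fun k => normc (v k)).
  by rewrite -!absE -(E (@normc R)) -absE => /(_ su sv)[].
have normed (f : R[i] -> R) (w : nat -> R[i]) : (forall z, `|f z| <= normc z) ->
    csummable w -> cvgn (series (fun k => `|f (w k)|)).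
  move=> fle; apply: cvg_series_dominated => k; rewrite normr_id; exact: fle.
rewrite /csum (E (@complex.Re R)) (E (@complex.Im R)).
by congr Complex; apply: (cvg_series_interleave _ _).2; apply: normed => //;
  (exact: Re_le_normc || exact: Im_le_normc).
Qed.

End interleave.

Section signed_compound_poisson.
Variable R : realType.
Implicit Types (t : R) (z w : R[i]) (phi psi : R -> R[i]).

Definition expi t : R[i] := Cexp (Complex 0 t).

Lemma expiE t : expi t = Complex (cos t) (sin t).
Proof. by rewrite /expi /Cexp/= expR0 mul1r. Qed.

Lemma expi0 : expi 0 = 1.
Proof. exact: Cexp0. Qed.

Lemma expiD s t : expi (s + t) = expi s * expi t.
Proof.
rewrite /expi -CexpD; congr Cexp.
by apply/eqP; rewrite eq_complex/= addr0 !eqxx.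
Qed.

Lemma expiX t k : expi (k%:R * t) = expi t ^+ k.
Proof.
elim: k => [|k ih]; first by rewrite mul0r expi0.
by rewrite exprS -ih -expiD -natr1 mulrDl mul1r addrC.
Qed.

Lemma normc_expi t : normc (expi t) = 1.
Proof. by rewrite expiE/= cos2Dsin2 sqrtr1. Qed.

Lemma expi_neq0 t : expi t != 0.
Proof.
apply/eqP => /(congr1 (@normc R)); rewrite normc_expi normc0 => /eqP.
by rewrite oner_eq0.
Qed.

Lemma expiN t : expi (- t) = (expi t)^-1.
Proof.
apply: (mulfI (expi_neq0 t)); rewrite -expiD subrr expi0 divff//.
exact: expi_neq0.
Qed.

Definition jump_term (b x : nat -> R) t (k : nat) : R[i] :=
  real_complex R (b k) * (expi (x k * t) - 1).

(** The shape of the characteristic function of a quasi-infinitely divisible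
distribution with a finite, purely atomic quasi-Levy measure and no Gaussian
part.  If the [b k] were nonnegative, this would be a shifted compound Poisson
distribution. *)
Definition signed_compound_poisson phi : Prop :=
  exists (gamma : R) (b x : nat -> R),
    [/\ cvgn (series (fun k => `|b k|)),
        forall k, x k = 0 -> b k = 0 &
        forall t, phi t = expi (gamma * t) * Cexp (csum (jump_term b x t))].

Lemma csummable_jump (b x : nat -> R) t : cvgn (series (fun k => `|b k|)) ->
  csummable (jump_term b x t).
Proof.
move=> cb; apply: (@csummable_dominated _ _ (fun k => 2 * `|b k|)).
  move=> k; rewrite normcM normc_real mulrC ler_wpM2r//.
  apply: (le_trans (le_normcD _ _)).
  by rewrite normcN normc1 normc_expi.
exact: (@is_cvg_seriesZ R (fun k => `|b k|) 2).
Qed.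

Lemma signed_compound_poissonM phi psi : signed_compound_poisson phi ->
  signed_compound_poisson psi ->
  signed_compound_poisson (fun t => phi t * psi t).
Proof.
move=> [g1 [b1 [x1 [cb1 bx1 E1]]]] [g2 [b2 [x2 [cb2 bx2 E2]]]].
exists (g1 + g2), (interleave b1 b2), (interleave x1 x2); split.
- exact: (cvg_series_interleave cb1 cb2).1.
- by move=> k; rewrite /interleave; case: ifP => _; [exact: bx2|exact: bx1].
- move=> t; rewrite E1 E2 mulrDl expiD mulrACA -[X in _ * X]CexpD.
  have c1 := @csummable_jump b1 x1 t cb1; have c2 := @csummable_jump b2 x2 t cb2.
  rewrite -(csum_interleave c1 c2).2.
  congr (_ * Cexp (csum _)); apply/funext => k.
  by rewrite /jump_term /interleave; case: ifP.
Qed.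

Lemma signed_compound_poisson_dilate phi (h : R) : h != 0 ->
  signed_compound_poisson phi ->
  signed_compound_poisson (fun t => phi (h * t)).
Proof.
move=> h0 [g [b [x [cb bx E]]]]; exists (g * h), b, (fun k => x k * h); split => //.
- move=> k /eqP; rewrite mulf_eq0 (negbTE h0) orbF => /eqP; exact: bx.
- move=> t; rewrite E mulrA; congr (_ * Cexp (csum _)).
  by apply/funext => k; rewrite /jump_term mulrA.
Qed.

Lemma signed_compound_poisson_shift phi (s : R) : signed_compound_poisson phi ->
  signed_compound_poisson (fun t => expi (s * t) * phi t).
Proof.
move=> [g [b [x [cb bx E]]]]; exists (s + g), b, x; split => // t.
by rewrite E mulrA mulrDl expiD.
Qed.

(** Each factor is [exp (sum_k (u ^ k - (u * w) ^ k) / k)] with [w = expi t], so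
the atom at [k] has mass [- (sum_u u ^ k) / k].  The power sum is real because
it is invariant under conjugation. *)
Lemma signed_compound_poisson_prod (s : seq R[i]) :
  all (fun u => normc u < 1) s ->
  perm_eq s (map conjc s) ->
  signed_compound_poisson
    (fun t => \prod_(u <- s) ((1 - u * expi t) / (1 - u))).
Proof.
move=> s1 sconj.
pose P k := \sum_(u <- s) u ^+ k.
have PR k : P k = real_complex R (complex.Re (P k)).
  have : (P k)^*%C = P k.
    rewrite /P [RHS](perm_big _ sconj)/= big_map rmorph_sum.
    by apply: eq_bigr => u _; rewrite rmorphXn.
  case: (P k) => a b [] /eqP; rewrite eq_sym -subr_eq0 opprK -mulr2n.
  by rewrite mulrn_eq0 /= => /eqP ->.
pose b k := - (complex.Re (P k) / k%:R).
have cP : cvgn (series (fun k => \sum_(u <- s) normc u ^+ k)).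
  elim: {P PR b sconj} s s1 => [_|u s ih /andP[u1 /ih cs]].
    under eq_fun do rewrite big_nil.
    by rewrite /series/=; under eq_fun do rewrite big1//; exact: is_cvg_cst.
  under eq_fun do rewrite big_cons.
  apply: (@is_cvg_seriesD R (fun k => normc u ^+ k)) => //.
  have := csummable_geometric u1; rewrite /csummable.
  by under eq_fun do rewrite normcX.
exists 0, b, (fun k : nat => k%:R); split.
- apply: cvg_series_dominated cP => k; rewrite normr_id /b normrN.
  case: k => [|k]; first by rewrite invr0 mulr0 normr0 sumr_ge0// => v _;
    rewrite exprn_ge0 ?normc_ge0.
  rewrite normrM normfV normr_nat.
  apply: (@le_trans _ _ `|complex.Re (P k.+1)|).
    by rewrite ler_piMr// invf_le1// ler1n.
  apply: (le_trans (Re_le_normc _)); apply: (le_trans (normc_sum _ _)).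
  by apply: ler_sum => u _; rewrite normcX.
- move=> k /eqP; rewrite pnatr_eq0 => /eqP ->.
  by rewrite /b invr0 mulr0 oppr0.
- move=> t; rewrite mul0r expi0 mul1r.
  have E u : u \in s -> (1 - u * expi t) / (1 - u) =
      Cexp (neg_log1m u - neg_log1m (u * expi t)).
    move=> us; have u1 := allP s1 _ us.
    have uw1 : normc (u * expi t) < 1 by rewrite normcM normc_expi mulr1.
    rewrite CexpD -(Cexp_neg_log1m uw1) -(Cexp_neg_log1m u1) mulrC; congr (_ * _).
    have : Cexp (- neg_log1m u) != 0.
      apply/eqP => e; have := CexpN (neg_log1m u); rewrite e mulr0 => /eqP.
      by rewrite eq_sym oner_eq0.
    by move=> e0; apply: (mulfI e0); rewrite divff// mulrC CexpN.
  rewrite big_seq (eq_bigr _ E) -big_seq -Cexp_sum; congr Cexp.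
  have sF u : u \in s ->
      csummable (fun k => u ^+ k / k%:R + - 1 * ((u * expi t) ^+ k / k%:R)) /\
      csum (fun k => u ^+ k / k%:R + - 1 * ((u * expi t) ^+ k / k%:R)) =
        neg_log1m u - neg_log1m (u * expi t).
    move=> us; have u1 := allP s1 _ us.
    have uw1 : normc (u * expi t) < 1 by rewrite normcM normc_expi mulr1.
    have c1 := csummable_neg_log1m u1; have c2 := csummable_neg_log1m uw1.
    have c3 := csummableZ (z := -1) c2.
    by split; [exact: csummableD|rewrite csumD// csumZ// mulN1r].
  transitivity (\sum_(u <- s)
      csum (fun k => u ^+ k / k%:R + - 1 * ((u * expi t) ^+ k / k%:R))).
    by apply: eq_big_seq => u us; have [_ ->] := sF u us.
  rewrite -(csum_big _).2; last by move=> u us; have [] := sF u us.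
  congr csum; apply/funext => k; rewrite /jump_term expiX.
  have -> : real_complex R (b k) = - (P k / k%:R).
    by rewrite /b [P k in RHS]PR rmorphN rmorphM/= fmorphV rmorph_nat.
  rewrite /P mulNr -mulrN opprB mulrAC !mulr_suml.
  by apply: eq_bigr => u _; rewrite exprMn; ring.
Qed.

End signed_compound_poisson.

(** * Polynomials without zeros on the unit circle *)
Section roots.
Variable F : fieldType.

Lemma prod_XsubC_inj (s s' : seq F) :
  \prod_(z <- s) ('X - z%:P) = \prod_(z <- s') ('X - z%:P) -> perm_eq s s'.
Proof.
elim: s s' => [|a s ih] s' E.
  have := congr1 (fun p : {poly F} => size p) E.
  by rewrite !size_prod_XsubC => -[] /esym /size0nil ->.
have as' : a \in s'.
  by rewrite -root_prod_XsubC -E root_prod_XsubC inE eqxx.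
rewrite perm_sym (perm_trans (perm_to_rem as'))// perm_cons perm_sym ih//.
have a0 : 'X - a%:P != 0 by rewrite polyXsubC_eq0.
by move: E; rewrite (perm_big _ (perm_to_rem as'))/= !big_cons => /(mulfI a0).
Qed.

End roots.

Section polynomial_transform.
Variable R : realType.

(** Conjugation fixes a polynomial with real coefficients, hence permutes its
roots with their multiplicities. *)
Lemma roots_conj (p : {poly R}) (s : seq R[i]) (a : R[i]) : p != 0 ->
  map_poly (real_complex R) p = a *: \prod_(z <- s) ('X - z%:P) ->
  perm_eq s (map conjc s).
Proof.
move=> p0 pE; apply: prod_XsubC_inj; rewrite big_map.
have conjP : map_poly conjc (map_poly (real_complex R) p) =
    map_poly (real_complex R) p.
  by apply/polyP => k; rewrite !coef_map/= oppr0.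
have aE : a = real_complex R (lead_coef p).
  have := congr1 lead_coef pE; rewrite lead_coef_map lead_coefZ.
  by rewrite lead_coef_prod_XsubC mulr1.
have a0 : a != 0 by rewrite aE fmorph_eq0 lead_coef_eq0.
apply: (scalerI a0); rewrite -pE -conjP pE map_polyZ/=.
have -> : conjc a = a by rewrite aE/= oppr0.
by rewrite map_prod_XsubC.
Qed.

(** Dividing by [p.[1] = 1] normalizes the factor of a root [z] to
[(w - z) / (1 - z)].  For [|z| > 1] this is [(1 - u * w) / (1 - u)] with
[u = z^-1], and for [|z| < 1] it is [w * ((1 - z * w^-1) / (1 - z))]; the
inverse of [w = expi t] is accounted for by the dilation [t |-> - t]. *)
Lemma signed_compound_poisson_horner (p : {poly R}) : p.[1] = 1 ->
  (forall w, normc w = 1 -> (map_poly (real_complex R) p).[w] != 0) ->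
  signed_compound_poisson (fun t => (map_poly (real_complex R) p).[expi t]).
Proof.
move=> p1 pnz; set P := map_poly _ p in pnz *.
have P1 : P.[1] = 1.
  by rewrite /P -(rmorph1 (real_complex R)) horner_map/= p1.
have [rs Prs] := closed_field_poly_normal P.
have p0 : p != 0 by apply: contra_eq_neq p1 => ->; rewrite horner0 eq_sym oner_eq0.
have rsconj := roots_conj p0 Prs.
have PE w : P.[w] = lead_coef P * \prod_(z <- rs) (w - z).
  rewrite [in LHS]Prs hornerZ horner_prod; congr (_ * _).
  by apply: eq_bigr => z _; rewrite hornerXsubC.
have rs1 z : z \in rs -> normc z != 1.
  move=> zrs; apply/eqP => /pnz; rewrite PE => /eqP; apply.
  by rewrite (big_rem z)//= subrr mul0r mulr0.
have PE1 w : P.[w] = \prod_(z <- rs) ((w - z) / (1 - z)).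
  have := P1; rewrite PE => l1.
  rewrite PE -[LHS]divr1 -[X in _ / X]l1 -mulf_div divff ?mul1r ?prodf_div//.
  by apply: contra_eq_neq l1 => ->; rewrite mul0r eq_sym oner_eq0.
pose out := [pred z : R[i] | 1 < normc z].
pose s1 := [seq z^-1 | z <- rs & out z].
pose s2 := [seq z <- rs | ~~ out z].
have outJ : {mono conjc : z / out z} by move=> [x y]; rewrite /out/= sqrrN.
have filterJ (a : pred R[i]) : {mono conjc : z / a z} ->
    map conjc (seq.filter a rs) = seq.filter a (map conjc rs).
  move=> aJ; rewrite seq.filter_map; congr map.
  by apply: eq_filter => z; rewrite /= aJ.
have s1J : perm_eq s1 (map conjc s1).
  rewrite [map conjc s1](_ : _ = map GRing.inv (map conjc (seq.filter out rs))).
    2: by rewrite -!map_comp; apply: eq_map => z; exact: conjc_inv.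
  by apply: perm_map; rewrite filterJ//; exact: perm_filter.
have s2J : perm_eq s2 (map conjc s2).
  rewrite /s2 filterJ; first exact: perm_filter.
  by move=> z; rewrite outJ.
have s1lt : all (fun u => normc u < 1) s1.
  apply/allP => _ /mapP[z + ->]; rewrite mem_filter /= => /andP[z1 _].
  by rewrite normcV invf_lt1// (lt_trans ltr01).
have s2lt : all (fun u => normc u < 1) s2.
  apply/allP => z; rewrite mem_filter /= => /andP[z1 /rs1].
  by rewrite lt_neqAle => ->; rewrite leNgt.
have -> : (fun t => P.[expi t]) = (fun t => expi ((size s2)%:R * t) *
    (\prod_(u <- s1) ((1 - u * expi t) / (1 - u)) *
     \prod_(u <- s2) ((1 - u * expi (- 1 * t)) / (1 - u)))).
  apply/funext => t; rewrite PE1 (bigID out)/= mulrCA.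
  congr (_ * _).
    rewrite /s1 big_map big_filter/= big_seq_cond [RHS]big_seq_cond.
    apply: eq_bigr => z /andP[/rs1 z1 oz].
    have z0 : z != 0 by apply: contraTneq oz => ->; rewrite normc0 ltr10.
    have z11 : 1 - z != 0.
      by rewrite subr_eq0; apply: contra_neq z1 => <-; rewrite normc1.
    have z12 : z - 1 != 0 by rewrite -opprB oppr_eq0.
    by field; rewrite z0 z11 z12.
  rewrite mulN1r expiX -big_filter -/s2.
  rewrite (_ : _ ^+ _ = \prod_(z <- s2) expi t); last first.
    by rewrite big_const_seq count_predT -Monoid.iteropE.
  rewrite -big_split/=; apply: eq_bigr => z _; rewrite expiN mulrA; congr (_ / _).
  by rewrite mulrBr mulr1 mulrCA divff ?mulr1// expi_neq0.
apply: signed_compound_poisson_shift; apply: signed_compound_poissonM.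
  exact: signed_compound_poisson_prod.
apply: (signed_compound_poisson_dilate _ (signed_compound_poisson_prod s2lt s2J)).
by rewrite oppr_eq0 oner_eq0.
Qed.

End polynomial_transform.

(** * The total variation of the quasi-Levy measure *)
Section quasi_levy_variation.
Variable R : realType.

(** At 0 the inverse of 0 makes this density vanish, in agreement with the
convention that the quasi-Levy measure has no mass at 0. *)
Definition levy_weight (x : R) : R := (Num.min 1 (x ^+ 2))^-1.

Lemma measurable_inv : measurable_fun [set: R] (fun x => x^-1).
Proof.
have oD : open [set x : R | x != 0].
  rewrite (_ : [set _ | _] = ~` [set 0]); first exact: closed_openC.
  by apply/seteqP; split => x /= /eqP.
rewrite (_ : [set: R] = [set 0] `|` [set x | x != 0]); last first.
  by apply/seteqP; split => x //= _; have [->|x0] := eqVneq x 0; [left|right].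
apply/measurable_funU => //; first exact: open_measurable.
split; first exact: measurable_fun_set1.
apply: open_continuous_measurable_fun => // x; rewrite inE/= => x0.
exact: inv_continuous.
Qed.

Lemma measurable_levy_weight : measurable_fun [set: R] levy_weight.
Proof.
apply: (measurableT_comp measurable_inv).
by apply: measurable_minr => //; exact: exprn_measurable.
Qed.

Lemma levy_weight_ge0 (x : R) : 0 <= levy_weight x.
Proof. by rewrite invr_ge0 le_min ler01 sqr_ge0. Qed.

Section with_density.
Context d (T : measurableType d) (m : {measure set T -> \bar R}).

(** The two proofs are arguments so that the measure structure can be
inferred. *)
Definition with_density (f : T -> R) of (forall x, 0 <= f x)
    & measurable_fun setT f :=
  fun A : set T => (\int[m]_(x in A) (f x)%:E)%E.

Variables (f : T -> R) (f0 : forall x, 0 <= f x) (mf : measurable_fun setT f).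
Local Notation density_measure := (with_density f0 mf).

Let density0 : density_measure set0 = 0%E.
Proof. exact: integral_set0. Qed.

Let density_ge0 A : (0 <= density_measure A)%E.
Proof. by apply: integral_ge0 => x _; rewrite lee_fin. Qed.

Let density_sigma_additive : semi_sigma_additive density_measure.
Proof.
apply: semi_sigma_additive_nng_induced; last by move=> x; rewrite lee_fin.
exact/measurable_EFinP.
Qed.

HB.instance Definition _ := isMeasure.Build _ _ _ density_measure
  density0 density_ge0 density_sigma_additive.

End with_density.
End quasi_levy_variation.

Section charge_parts.
Context d (T : measurableType d) (R : realType).
Variable zeta : {charge set T -> \bar R}.
Let P := hahn_pos zeta.
Let N := hahn_neg zeta.

Let mP : measurable P. Proof. by have [[]] := hahn_posneg zeta. Qed.
Let mN : measurable N. Proof. by have [_ []] := hahn_posneg zeta. Qed.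

Lemma charge_posE (A : set T) : measurable A ->
  charge_pos zeta A = zeta (A `&` P).
Proof.
move=> mA; rewrite -[LHS]/(crestr0 zeta mP A).
by rewrite /crestr0 mem_set.
Qed.

Lemma charge_negE (A : set T) : measurable A ->
  charge_neg zeta A = (- zeta (A `&` N))%E.
Proof.
move=> mA; rewrite -[LHS]/(cscale (-1) (crestr0 zeta mN) A).
by rewrite cscaleN1 /= /crestr0 mem_set.
Qed.

Lemma charge_total_variationE (A : set T) : measurable A ->
  charge_total_variation zeta A = (zeta (A `&` P) - zeta (A `&` N))%E.
Proof.
move=> mA; rewrite -[LHS]/(charge_pos zeta A + charge_neg zeta A)%E.
by rewrite charge_posE// charge_negE.
Qed.

End charge_parts.

Section quasi_levy_variation.
Variable R : realType.
Variable zeta : {charge set R -> \bar R}.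
Let P := hahn_pos zeta.
Let N := hahn_neg zeta.

Let mP : measurable P. Proof. by have [[]] := hahn_posneg zeta. Qed.
Let mN : measurable N. Proof. by have [_ []] := hahn_posneg zeta. Qed.
Let PN : P `&` N = set0. Proof. by have [] := hahn_posneg zeta. Qed.
Let PNT : P `|` N = setT. Proof. by have [] := hahn_posneg zeta. Qed.

Let mw (A : set R) : measurable_fun A (fun x => (levy_weight x)%:E).
Proof.
by apply: measurable_funTS; apply/measurable_EFinP; exact: measurable_levy_weight.
Qed.

Let integral_neg0 (A : set R) : measurable A -> A `<=` P ->
  (\int[charge_neg zeta]_(x in A) (levy_weight x)%:E)%E = 0%E.
Proof.
move=> mA AP; apply: null_set_integral => //.
apply: etrans (charge_negE zeta mA) _; rewrite (_ : A `&` N = set0) ?charge0 ?oppe0//.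
by apply/seteqP; split => x // [/AP Px Nx]; rewrite -PN.
Qed.

Let integral_pos0 (A : set R) : measurable A -> A `<=` N ->
  (\int[charge_pos zeta]_(x in A) (levy_weight x)%:E)%E = 0%E.
Proof.
move=> mA AN; apply: null_set_integral => //.
apply: etrans (charge_posE zeta mA) _; rewrite (_ : A `&` P = set0) ?charge0//.
by apply/seteqP; split => x // [/AN Nx Px]; rewrite -PN.
Qed.

(** A positive density does not change the sign of a charge, so that |nu| is the
total variation of [zeta] with the density [levy_weight]. *)
Definition quasi_levy_variation : {measure set R -> \bar R} :=
  with_density (measure_add (charge_pos zeta) (charge_neg zeta))
    (@levy_weight_ge0 R) (@measurable_levy_weight R).

Lemma quasi_levy_variationE (A : set R) : measurable A ->
  quasi_levy_variation A =
  (\int[charge_pos zeta]_(x in A) (levy_weight x)%:E +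
   \int[charge_neg zeta]_(x in A) (levy_weight x)%:E)%E.
Proof.
move=> mA; rewrite /quasi_levy_variation/= /with_density.
rewrite ge0_integral_measure_add//.
by move=> x _; rewrite lee_fin levy_weight_ge0.
Qed.

Let measurable_away (r : {posnum R}) : measurable (away r%:num).
Proof. by apply: measurableC; exact: measurable_itv. Qed.

Let restr_pos (r : {posnum R}) (A : set R) : measurable A -> A `<=` P ->
  quasi_levy_restr zeta r A =
  (\int[charge_pos zeta]_(x in A `&` away r%:num) (levy_weight x)%:E)%E.
Proof.
move=> mA AP; rewrite /quasi_levy_restr /quasi_levy /charge_integral.
rewrite -/levy_weight integral_neg0 ?sube0//; first exact: measurableI.
by move=> x [/AP].
Qed.

Let restr_neg (r : {posnum R}) (A : set R) : measurable A -> A `<=` N ->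
  quasi_levy_restr zeta r A =
  (- \int[charge_neg zeta]_(x in A `&` away r%:num) (levy_weight x)%:E)%E.
Proof.
move=> mA AN; rewrite /quasi_levy_restr /quasi_levy /charge_integral.
rewrite -/levy_weight integral_pos0 ?add0e//; first exact: measurableI.
by move=> x [/AN].
Qed.

Let integral_w_ge0 (m : {measure set R -> \bar R}) (A : set R) :
  (0 <= \int[m]_(x in A) (levy_weight x)%:E)%E.
Proof. by apply: integral_ge0 => x _; rewrite lee_fin levy_weight_ge0. Qed.

(** On subsets of [P] the negative part of [zeta] does not contribute, and on
subsets of [N] the positive part does not. *)
Lemma hahn_quasi_levy_restr (r : {posnum R}) :
  hahn_decomposition (quasi_levy_restr zeta r) P N.
Proof.
split => //; split => // A mA AS.
- by rewrite -[leRHS]/(quasi_levy_restr zeta r A) restr_pos.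
- by rewrite -[leLHS]/(quasi_levy_restr zeta r A) restr_neg// oppe_le0.
Qed.

Lemma quasi_levy_variationP : is_quasi_levy_variation zeta quasi_levy_variation.
Proof.
split.
  rewrite /quasi_levy_variation/= /with_density integral0_eq// => x /= ->.
  by rewrite /levy_weight expr0n/= min_r// invr0.
move=> r B mB Br.
have h := hahn_posneg (quasi_levy_restr zeta r).
have [uP uN] := Hahn_decomposition_uniq h (hahn_quasi_levy_restr r) mB.
rewrite (charge_total_variationE (quasi_levy_restr zeta r) mB).
rewrite [X in (X - _)%E]uP [X in (_ - X)%E]uN.
rewrite -[X in (X - _)%E]/(quasi_levy_restr zeta r _).
rewrite -[X in (_ - X)%E]/(quasi_levy_restr zeta r _).
rewrite restr_pos ?restr_neg//; try exact: measurableI.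
have BE C : B `&` C `&` away r%:num = B `&` C.
  by apply/seteqP; split => [x []//|x [Bx Cx]]; split => //; exact: Br.
rewrite oppeK !BE quasi_levy_variationE//.
have split_int (m : {measure set R -> \bar R}) :
    (\int[m]_(x in B) (levy_weight x)%:E =
     \int[m]_(x in B `&` P) (levy_weight x)%:E +
     \int[m]_(x in B `&` N) (levy_weight x)%:E)%E.
  rewrite -ge0_integral_setU//; try exact: measurableI.
  - by rewrite -setIUr PNT setIT.
  - by move=> x _; rewrite lee_fin levy_weight_ge0.
  - by apply/disj_setPS => x [[_ Px] [_ Nx]]; rewrite -PN.
have mBP : measurable (B `&` P) by exact: measurableI.
have mBN : measurable (B `&` N) by exact: measurableI.
by rewrite !split_int (integral_pos0 mBN)// (integral_neg0 mBP)// adde0 add0e.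
Qed.

End quasi_levy_variation.

(** * Differences of finite measures *)

Lemma sub_eq_add_eq (R : realDomainType) (a b p n : \bar R) :
  a \is a fin_num -> b \is a fin_num -> p \is a fin_num -> n \is a fin_num ->
  (a - b = p - n -> p + b = a + n)%E.
Proof.
case: a b p n => [a||] [b||] [p||] [n||]// _ _ _ _ [] E.
by rewrite -!EFinD; congr EFin; apply/eqP; rewrite -subr_eq -addrAC -E subrK.
Qed.

Section charge_difference.
Context d (T : measurableType d) (R : realType).
Variables (m1 m2 : {finite_measure set T -> \bar R}).

Definition charge_difference : {charge set T -> \bar R} :=
  cadd (charge_of_finite_measure m1)
    (cscale (-1) (charge_of_finite_measure m2)).

Local Notation zeta := charge_difference.

Lemma charge_differenceE (A : set T) : zeta A = (m1 A - m2 A)%E.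
Proof.
by rewrite -[LHS]/(m1 A + (-1)%:E * m2 A)%E EFinN mulN1e.
Qed.

Let mP : measurable (hahn_pos zeta). 
Proof. by have [[]] := hahn_posneg zeta. Qed.
Let mN : measurable (hahn_neg zeta).
Proof. by have [_ []] := hahn_posneg zeta. Qed.

Lemma charge_pos_le (A : set T) : measurable A -> (charge_pos zeta A <= m1 A)%E.
Proof.
move=> mA; rewrite charge_posE// charge_differenceE.
apply: (@le_trans _ _ (m1 (A `&` hahn_pos zeta))).
  by rewrite geeDl// oppe_le0.
by apply: le_measure; rewrite ?inE//; exact: measurableI.
Qed.

Lemma charge_neg_le (A : set T) : measurable A -> (charge_neg zeta A <= m2 A)%E.
Proof.
move=> mA; rewrite charge_negE// charge_differenceE.
rewrite fin_num_oppeB ?fin_num_measure//; try exact: measurableI.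
apply: (@le_trans _ _ (m2 (A `&` hahn_neg zeta))).
  by rewrite geeDr// oppe_le0.
by apply: le_measure; rewrite ?inE//; exact: measurableI.
Qed.

Let integrable_le (m n : {measure set T -> \bar R}) (f : T -> \bar R) :
  (forall A, measurable A -> (m A <= n A)%E) ->
  n.-integrable setT f -> m.-integrable setT f.
Proof.
move=> mn /integrableP[mf foo]; apply/integrableP; split => //.
apply: le_lt_trans foo; apply: ge0_le_measure_integral => //.
exact: measurableT_comp.
Qed.

(** Integration against a charge may use any two finite measures with the right
difference: from [m1 - m2 = pos - neg] follows [pos + m2 = m1 + neg] between
measures, and both sides can be integrated. *)
Lemma charge_integral_difference (f : T -> \bar R) :
  m1.-integrable setT f -> m2.-integrable setT f ->
  charge_integral zeta setT f = (\int[m1]_x f x - \int[m2]_x f x)%E.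
Proof.
move=> f1 f2.
have fp := integrable_le charge_pos_le f1.
have fn := integrable_le charge_neg_le f2.
have [mf _] := integrableP _ _ _ f1.
have : (\int[measure_add (charge_pos zeta) m2]_x f x =
        \int[measure_add m1 (charge_neg zeta)]_x f x)%E.
  apply: eq_measure_integral => A mA _.
  rewrite -[LHS]/(measure_add (charge_pos zeta) m2 A) measure_addE.
  rewrite -[RHS]/(measure_add m1 (charge_neg zeta) A) measure_addE.
  have E : zeta A = (charge_pos zeta A - charge_neg zeta A)%E.
    rewrite [LHS](jordan_decomp (hahn_posneg zeta) mA).
    by rewrite -[LHS]/(charge_pos zeta A + (-1)%:E * charge_neg zeta A)%E EFinN mulN1e.
  move: E; rewrite charge_differenceE.
  by apply: sub_eq_add_eq; exact: fin_num_measure.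
rewrite !integral_measure_add//.
move: (integrable_fin_num measurableT fp) (integrable_fin_num measurableT fn).
move: (integrable_fin_num measurableT f1) (integrable_fin_num measurableT f2).
rewrite /charge_integral.
move: (\int[charge_pos zeta]_x f x)%E (\int[charge_neg zeta]_x f x)%E.
move: (\int[m1]_x f x)%E (\int[m2]_x f x)%E.
case=> // x [] // y p n _ _; case: p n => // p [] // n _ _ [] h.
by rewrite -!EFinB; congr EFin; lra.
Qed.

End charge_difference.

(** * Atomic measures and charges *)

Lemma nneseries_EFin (R : realType) (f : nat -> R) : cvgn (series f) ->
  (\sum_(k <oo) (f k)%:E)%E = (limn (series f))%:E.
Proof.
move=> cf; rewrite -EFin_lim//; congr (limn _).
by apply/funext => n /=; rewrite sumEFin.
Qed.

Section atomic.
Context d (T : measurableType d) (R : realType).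

(** The summability is an argument so that finiteness can be inferred. *)
Definition atomic (b : nat -> R) (x : nat -> T) (b0 : forall k, 0 <= b k)
    & cvgn (series b) : set T -> \bar R :=
  mseries (fun k => mscale (NngNum (b0 k)) (\d_ (x k))) 0.

Section atomic_measure.
Variables (b : nat -> R) (x : nat -> T).
Variables (b0 : forall k, 0 <= b k) (cb : cvgn (series b)).

HB.instance Definition _ := Measure.on (atomic x b0 cb).

Lemma ge0_integral_atomic (f : T -> \bar R) : measurable_fun setT f ->
  (forall y, 0 <= f y)%E ->
  (\int[atomic x b0 cb]_y f y = \sum_(k <oo) (b k)%:E * f (x k))%E.
Proof.
move=> mf f0; rewrite /atomic ge0_integral_measure_series//.
apply: eq_eseriesr => k _; rewrite ge0_integral_mscale//.
by rewrite integral_dirac// diracE mem_set// mul1e.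
Qed.

Lemma atomicT : (atomic x b0 cb setT = (limn (series b))%:E)%E.
Proof.
rewrite -nneseries_EFin// /atomic /mseries; apply: eq_eseriesr => k _.
by rewrite -[LHS]/((b k)%:E * \d_(x k) setT)%E diracE mem_set// mule1.
Qed.

Let atomic_fin : fin_num_fun (atomic x b0 cb).
Proof.
move=> A mA; rewrite ge0_fin_numE//.
apply: (@le_lt_trans _ _ (atomic x b0 cb setT)); last by rewrite atomicT ltry.
by apply: le_measure; rewrite ?inE.
Qed.

HB.instance Definition _ := @Measure_isFinite.Build _ _ _ (atomic x b0 cb)
  atomic_fin.

Lemma integral_atomic (f : T -> R) : measurable_fun setT f ->
  cvgn (series (fun k => b k * `|f (x k)|)) ->
  (atomic x b0 cb).-integrable setT (EFin \o f) /\
  (\int[atomic x b0 cb]_y (f y)%:E =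
    (limn (series (fun k => b k * f (x k))))%:E)%E.
Proof.
move=> mf cf; have mf' : measurable_fun setT (EFin \o f) by exact/measurable_EFinP.
split.
  apply/integrableP; split => //.
  rewrite ge0_integral_atomic//; last exact: measurableT_comp.
  under eq_eseriesr do rewrite /= -EFinM.
  by rewrite nneseries_EFin// ltry.
have cp (s : R) : (forall k, `|Num.max (s * f (x k)) 0| <= `|f (x k)|) ->
    cvgn (series (fun k => b k * Num.max (s * f (x k)) 0)).
  move=> le; apply: cvg_series_dominated cf => k.
  by rewrite normrM (ger0_norm (b0 k)) ler_wpM2l.
have le1 k : `|Num.max (1 * f (x k)) 0| <= `|f (x k)|.
  by rewrite mul1r /Num.max; case: ifP => _; rewrite ?normr0 ?lexx ?normr_ge0.
have le2 k : `|Num.max (-1 * f (x k)) 0| <= `|f (x k)|.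
  by rewrite mulN1r /Num.max; case: ifP => _; rewrite ?normr0 ?normrN ?lexx ?normr_ge0.
have {}cp1 := cp _ le1; have {cp}cp2 := cp _ le2.
rewrite integralE ge0_integral_atomic//; last exact: measurable_funepos.
rewrite ge0_integral_atomic//; last exact: measurable_funeneg.
transitivity (\sum_(k <oo) (b k * Num.max (1 * f (x k)) 0)%:E -
  \sum_(k <oo) (b k * Num.max (-1 * f (x k)) 0)%:E)%E.
  congr (_ - _)%E; apply: eq_eseriesr => k _.
    by rewrite funeposE /= EFinM mul1r EFin_max.
  by rewrite funenegE /= EFinM mulN1r EFin_max.
rewrite !nneseries_EFin// -EFinB; congr EFin.
rewrite -lim_seriesB//; congr (limn (series _)); apply/funext => k.
rewrite -[LHS]/(_ - _) -mulrBr; congr (_ * _).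
rewrite mul1r mulN1r /Num.max oppr_lt0.
by case: ltrgt0P => [_|_|->]; rewrite ?subr0 ?sub0r ?opprK ?oppr0 ?addr0.
Qed.

End atomic_measure.

Lemma atomic_set1 (b : nat -> R) (x : nat -> T) b0 cb (a : T) :
  measurable [set a] -> (forall k, x k = a -> b k = 0) ->
  @atomic b x b0 cb [set a] = 0%E.
Proof.
move=> ma bx; rewrite /atomic /mseries eseries0// => k _ _.
rewrite -[LHS]/((b k)%:E * \d_(x k) [set a])%E diracE.
by case: (boolP (_ \in _)); rewrite ?inE ?mule0// => /bx ->; rewrite mul0e.
Qed.

End atomic.

(** The charge [zeta] with mass [b k * min 1 (x k ^ 2)] at [x k], for which the
quasi-Levy measure has the mass [b k] there.  The points [x k] may coincide, so
the positive and negative masses need not be the Jordan decomposition. *)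
Section signed_jumps.
Variable R : realType.
Variables (b x : nat -> R).
Hypotheses (cb : cvgn (series (fun k => `|b k|)))
  (bx : forall k, x k = 0 -> b k = 0).

Local Notation damp k := (Num.min 1 (x k ^+ 2)).

Let damp01 k : 0 <= damp k <= 1.
Proof. by rewrite le_min ler01 sqr_ge0 ge_min lexx. Qed.

Let weight (s : R) k := Num.max (s * b k) 0 * damp k.

Let weight_ge0 s k : 0 <= weight s k.
Proof. by rewrite mulr_ge0 ?le_max ?lexx ?orbT//; case/andP: (damp01 k). Qed.

Let weight_le (s : R) k : `|s| = 1 -> weight s k <= `|b k| * damp k.
Proof.
move=> s1; rewrite ler_wpM2r//; first by case/andP: (damp01 k).
by rewrite ge_max normr_ge0 andbT (le_trans (ler_norm _))// normrM s1 mul1r.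
Qed.

Let cvg_weight (s : R) : `|s| = 1 -> cvgn (series (weight s)).
Proof.
move=> s1; apply: cvg_series_dominated cb => k.
rewrite ger0_norm// (le_trans (weight_le _ s1))// ler_piMr//.
by case/andP: (damp01 k).
Qed.

Let pos_part := atomic x (weight_ge0 1) (cvg_weight (normr1 R)).
Let neg_part := atomic x (weight_ge0 (-1)) (cvg_weight (normrN1 R)).

Definition jump_charge : {charge set R -> \bar R} :=
  charge_difference pos_part neg_part.

Lemma gaussian_variance_jump_charge : gaussian_variance jump_charge = 0%E.
Proof.
rewrite /gaussian_variance charge_differenceE.
have weight0 (r : R) k : x k = 0 -> weight r k = 0.
  by move=> /bx; rewrite /weight => ->; rewrite mulr0 maxxx mul0r.
rewrite [X in (X - _)%E]atomic_set1//; last exact: weight0.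
by rewrite [X in (_ - X)%E]atomic_set1 ?sube0//; exact: weight0.
Qed.

Lemma finite_quasi_levy_jump_charge : finite_quasi_levy jump_charge.
Proof.
exists (quasi_levy_variation jump_charge); split.
  exact: quasi_levy_variationP.
rewrite quasi_levy_variationE//.
have mw : measurable_fun [set: R] (fun y => (levy_weight y)%:E).
  by apply/measurable_EFinP; exact: measurable_levy_weight.
have w0 (y : R) : (0 <= (levy_weight y)%:E)%E by rewrite lee_fin levy_weight_ge0.
have fin (s : R) (s1 : `|s| = 1) :
    (\int[atomic x (weight_ge0 s) (cvg_weight s1)]_y (levy_weight y)%:E < +oo)%E.
  rewrite ge0_integral_atomic//.
  under eq_eseriesr do rewrite -EFinM.
  rewrite nneseries_EFin ?ltry//; apply: cvg_series_dominated cb => k.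
  rewrite ger0_norm; last by rewrite mulr_ge0 ?levy_weight_ge0 ?weight_ge0.
  apply: (@le_trans _ _ (`|b k| * damp k * levy_weight (x k))).
    by rewrite ler_wpM2r ?levy_weight_ge0// weight_le.
  rewrite -mulrA ler_piMr// /levy_weight.
  by have [->|d0] := eqVneq (damp k) 0; rewrite ?mul0r// divff.
apply: lte_add_pinfty.
  apply: le_lt_trans (fin _ (normr1 R)).
  by apply: ge0_le_measure_integral => //; exact: charge_pos_le.
apply: le_lt_trans (fin _ (normrN1 R)).
by apply: ge0_le_measure_integral => //; exact: charge_neg_le.
Qed.

Lemma charge_integral_jump_charge (f : R -> R) : measurable_fun setT f ->
  cvgn (series (fun k => `|b k * damp k * f (x k)|)) ->
  charge_integral jump_charge setT (EFin \o f) =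
    (limn (series (fun k => b k * damp k * f (x k))))%:E.
Proof.
move=> mf cf.
have cw (s : R) : `|s| = 1 -> cvgn (series (fun k => weight s k * `|f (x k)|)).
  move=> s1; apply: cvg_series_dominated cf => k.
  have d0 : 0 <= damp k by case/andP: (damp01 k).
  have -> : `|weight s k * `|f (x k)| | = weight s k * `|f (x k)|.
    by rewrite ger0_norm// mulr_ge0// weight_ge0.
  by rewrite [leRHS]normrM [X in _ <= X * _]normrM (ger0_norm d0) ler_wpM2r// weight_le.
have [i1 e1] := integral_atomic (weight_ge0 1) (cvg_weight (normr1 R)) mf
  (cw _ (normr1 R)).
have [i2 e2] := integral_atomic (weight_ge0 (-1)) (cvg_weight (normrN1 R)) mf
  (cw _ (normrN1 R)).
rewrite charge_integral_difference//.
rewrite [X in (X - _)%E]e1 [X in (_ - X)%E]e2 -EFinB; congr EFin.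
have cw' (s : R) : `|s| = 1 -> cvgn (series (fun k => weight s k * f (x k))).
  move=> /cw; apply: cvg_series_dominated => k.
  by rewrite normrM (ger0_norm (weight_ge0 _ _)).
rewrite -lim_seriesB; [|exact: cw' (normr1 R)|exact: cw' (normrN1 R)].
congr (limn (series _)); apply/funext => k.
rewrite -[LHS]/(_ - _) -mulrBl; congr (_ * _).
rewrite /weight -mulrBl mul1r mulN1r /Num.max oppr_lt0; congr (_ * _).
by case: ltrgt0P => [_|_|->]; rewrite ?subr0 ?sub0r ?opprK ?oppr0 ?addr0.
Qed.

Lemma charge_Cintegral_jump_charge (G : R -> R[i]) :
  measurable_fun setT (fun y => complex.Re (G y)) ->
  measurable_fun setT (fun y => complex.Im (G y)) ->
  csummable (fun k => real_complex R (b k * damp k) * G (x k)) ->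
  charge_Cintegral jump_charge G =
    csum (fun k => real_complex R (b k * damp k) * G (x k)).
Proof.
move=> mR mI cG; rewrite /charge_Cintegral.
have ReE k : complex.Re (real_complex R (b k * damp k) * G (x k)) =
    b k * damp k * complex.Re (G (x k)).
  by rewrite cReM/= mul0r subr0.
have ImE k : complex.Im (real_complex R (b k * damp k) * G (x k)) =
    b k * damp k * complex.Im (G (x k)).
  by rewrite cImM/= mul0r addr0.
rewrite (charge_integral_jump_charge mR); last first.
  apply: cvg_series_dominated cG => k; rewrite normr_id -ReE; exact: Re_le_normc.
rewrite (charge_integral_jump_charge mI); last first.
  apply: cvg_series_dominated cG => k; rewrite normr_id -ImE; exact: Im_le_normc.
rewrite /csum; congr (Complex (limn (series _)) (limn (series _)));
  by apply/funext => k; rewrite ?ReE ?ImE.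
Qed.

End signed_jumps.

(** * From the exponential form to quasi-infinite divisibility *)
Section exponential_form.
Variable R : realType.
Variables (c : R -> R) (hc : representation_function c).

Lemma imulE (t : R) : Complex (0 : R) (1 : R) * real_complex R t = Complex 0 t.
Proof.
by apply/eqP; rewrite eq_complex/=; apply/andP; split; apply/eqP; ring.
Qed.

Lemma g_levy_weight (y z : R) : y != 0 ->
  g_ c y z =
  (expi (y * z) - 1 - Complex 0 (z * c y)) * real_complex R (levy_weight y).
Proof.
by move=> y0; rewrite /g_ (negbTE y0) !imulE (mulrC z y) /levy_weight fmorphV.
Qed.

Lemma measurable_g_parts (z : R) :
  measurable_fun setT (fun y => complex.Re (g_ c y z)) /\
  measurable_fun setT (fun y => complex.Im (g_ c y z)).
Proof.
have [_ mc _] := hc.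
have ReE : (fun y => complex.Re (g_ c y z)) = (fun y =>
    if y == 0 then - (z ^+ 2 / 2) else (cos (y * z) - 1) * levy_weight y).
  apply/funext => y; case: ifPn => [/eqP ->|y0]; first by rewrite /g_ eqxx.
  by rewrite g_levy_weight// expiE/= mulr0 !subr0.
have ImE : (fun y => complex.Im (g_ c y z)) = (fun y =>
    if y == 0 then 0 else (sin (y * z) - z * c y) * levy_weight y).
  apply/funext => y; case: ifPn => [/eqP ->|y0]; first by rewrite /g_ eqxx.
  by rewrite g_levy_weight// expiE/= mulr0 add0r subr0.
have mw := @measurable_levy_weight R.
have mz : measurable_fun setT (fun y : R => y * z) by exact: measurable_funM.
split; [rewrite ReE|rewrite ImE]; apply: measurable_fun_ifT => //.
- exact: measurable_fun_eqr.
- apply: measurable_funM => //; apply: measurable_funB => //.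
  apply: (measurableT_comp _ mz).
  by apply: continuous_measurable_fun; exact: continuous_cos.
- exact: measurable_fun_eqr.
- apply: measurable_funM => //; apply: measurable_funB => //; last exact: measurable_funM.
  apply: (measurableT_comp _ mz).
  by apply: continuous_measurable_fun; exact: continuous_sin.
Qed.

(** The compensator [- i z c (x)] of [g_] is absent from the jump terms; it adds
up to the finite sum of the [b k * c (x k)], which is moved to the drift. *)
Lemma qid_signed_compound_poisson (mu : probability R R) :
  signed_compound_poisson (characteristic_function mu) ->
  qid_finite_no_gauss c mu.
Proof.
move=> [gamma [b [x [cb bx muE]]]].
have [[M [_ cM]] _ _] := hc.
have cbc : csummable (fun k => real_complex R (b k * c (x k))).
  apply: (@csummable_dominated _ _ (fun k => (M + 1) * `|b k|)); last first.
    exact: (@is_cvg_seriesZ R (fun k => `|b k|) (M + 1)).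
  move=> k; rewrite normc_real normrM mulrC ler_wpM2r//.
  by apply: cM => //; rewrite ltrDl.
pose drift := limn (series (fun k => b k * c (x k))).
have driftE : csum (fun k => real_complex R (b k * c (x k))) = real_complex R drift.
  rewrite /csum; congr Complex; rewrite /series/=.
  by under eq_fun do rewrite big1//; rewrite lim_cst.
exists (jump_charge x cb), (gamma + drift); split.
- move=> z; rewrite muE.
  have termE k : real_complex R (b k * Num.min 1 (x k ^+ 2)) * g_ c (x k) z =
      jump_term b x z k + Complex 0 (- z) * real_complex R (b k * c (x k)).
    rewrite /jump_term; have [x0|x0] := eqVneq (x k) 0.
      by rewrite (bx _ x0) !mul0r !mulr0 addr0.
    rewrite g_levy_weight// /levy_weight fmorphV rmorphM.
    have w0 : real_complex R (Num.min 1 (x k ^+ 2)) != 0.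
      rewrite fmorph_eq0 gt_eqF// lt_min ltr01 exprn_even_gt0//.
    rewrite [RHS](_ : _ = real_complex R (b k) *
      (expi (x k * z) - 1 - Complex 0 (z * c (x k)))).
      by rewrite -mulrA; congr (_ * _); rewrite mulrCA divff// mulr1.
    rewrite [RHS]mulrBr; congr (_ + _).
    by apply/eqP; rewrite eq_complex/=; apply/andP; split; apply/eqP; ring.
  have sterm : csummable (fun k => jump_term b x z k +
      Complex 0 (- z) * real_complex R (b k * c (x k))).
    apply: csummableD; first exact: csummable_jump.
    exact: (@csummableZ _ (Complex 0 (- z)) _ cbc).
  have [mR mI] := measurable_g_parts z.
  rewrite charge_Cintegral_jump_charge//; last first.
    by under eq_fun do rewrite termE.
  have -> : (fun k => real_complex R (b k * Num.min 1 (x k ^+ 2)) * g_ c (x k) z) =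
      (fun k => jump_term b x z k + Complex 0 (- z) * real_complex R (b k * c (x k))).
    by apply/funext.
  rewrite [X in Cexp (_ + X)]csumD; last 2 first.
    exact: csummable_jump.
    exact: (@csummableZ _ (Complex 0 (- z)) _ cbc).
  rewrite csumZ// driftE imulE /expi -CexpD; congr Cexp.
  rewrite addrCA addrC; congr (_ + _).
  by apply/eqP; rewrite eq_complex/=; apply/andP; split; apply/eqP; ring.
- exact: finite_quasi_levy_jump_charge.
- exact: gaussian_variance_jump_charge.
Qed.

End exponential_form.

(** * Lattice distributions *)
Section lattice.
Variable R : realType.
Implicit Types (p q : {poly R}).

Lemma cvg_poly_series p (f : nat -> R) :
  series (fun k => p`_k * f k) @ \oo --> \sum_(k < size p) p`_k * f k.
Proof.
apply: cvg_near_cst; exists (size p) => // n /= pn.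
rewrite /series/= (@big_cat_nat _ _ _ (size p))//= big_mkord.
rewrite [X in _ + X]big_nat_cond [X in _ + X]big1 ?addr0//.
by move=> k /andP[/andP[pk _] _]; rewrite nth_default// mul0r.
Qed.

Lemma is_cvg_coef_series p : cvgn (series (fun k => p`_k)).
Proof.
have := @cvg_poly_series p (fun=> 1).
by under eq_fun do rewrite mulr1; move=> /cvgP.
Qed.

Definition lattice_measure q (x : nat -> R) (q0 : forall k, 0 <= q`_k)
    & q.[1] = 1 : set R -> \bar R :=
  atomic x q0 (@is_cvg_coef_series q).

Section lattice_probability.
Variables (q : {poly R}) (x : nat -> R).
Variables (q0 : forall k, 0 <= q`_k) (q1 : q.[1] = 1).

HB.instance Definition _ := Measure.on (lattice_measure x q0 q1).

Let lattice_setT : lattice_measure x q0 q1 setT = 1%E.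
Proof.
rewrite [LHS]atomicT; congr EFin; apply/cvg_lim => //.
have E : \sum_(k < size q) q`_k * 1 = 1.
  by rewrite -[RHS]q1 horner_coef; apply: eq_bigr => k _; rewrite expr1n.
have := @cvg_poly_series q (fun=> 1); rewrite E.
by under eq_fun do rewrite mulr1.
Qed.

HB.instance Definition _ := @Measure_isProbability.Build _ _ _
  (lattice_measure x q0 q1) lattice_setT.

Definition lattice_probability : probability R R := lattice_measure x q0 q1.

Lemma Rintegral_lattice (f : R -> R) : measurable_fun setT f ->
  (\int[lattice_probability]_y f y)%R = \sum_(k < size q) q`_k * f (x k).
Proof.
move=> mf; rewrite /Rintegral.
have [|_ E] := @integral_atomic _ _ _ _ x q0 (@is_cvg_coef_series q) _ mf.
  by apply/cvgP/(@cvg_poly_series q (fun k => `|f (x k)|)).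
rewrite [X in fine X]E /=; apply/cvg_lim => //.
exact: (@cvg_poly_series q (fun k => f (x k))).
Qed.

End lattice_probability.

Lemma characteristic_lattice q (h a : R) (q0 : forall k, 0 <= q`_k)
    (q1 : q.[1] = 1) (t : R) :
  characteristic_function
    (lattice_probability (fun k => k%:R * h - a) q0 q1) t =
  expi (- a * t) * (map_poly (real_complex R) q).[expi (h * t)].
Proof.
have E y : Cexp (Complex (0 : R) 1 * real_complex R (t * y)) = expi (t * y).
  by rewrite imulE.
have mt : measurable_fun setT (fun y : R => t * y) by exact: measurable_funM.
pose e y := Cexp (Complex (0 : R) 1 * real_complex R (t * y)).
have ReE : (fun y => complex.Re (e y)) = (fun y => cos (t * y)).
  by apply/funext => y; rewrite /e E expiE.
have ImE : (fun y => complex.Im (e y)) = (fun y => sin (t * y)).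
  by apply/funext => y; rewrite /e E expiE.
rewrite /characteristic_function /Cintegral ReE ImE.
rewrite !Rintegral_lattice; last 2 first.
- apply: (measurableT_comp _ mt).
  by apply: continuous_measurable_fun; exact: continuous_sin.
- apply: (measurableT_comp _ mt).
  by apply: continuous_measurable_fun; exact: continuous_cos.
rewrite horner_coef size_map_poly mulr_sumr.
transitivity (\sum_(k < size q) real_complex R q`_k * expi (t * (k%:R * h - a))).
  apply/eqP; rewrite eq_complex.
  rewrite (big_morph _ (@cReD R) (erefl : complex.Re 0 = 0)).
  rewrite (big_morph _ (@cImD R) (erefl : complex.Im 0 = 0)).
  by apply/andP; split; apply/eqP; apply: eq_bigr => k _; rewrite expiE/=; ring.
apply: eq_bigr => k _; rewrite coef_map [RHS]mulrCA; congr (_ * _).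
by rewrite -expiX -expiD; congr expi; ring.
Qed.

(** The polynomial is [p (r X) / p (r)] for [r] close to 1.  It vanishes at a
point [w] of the circle only if [r * w] is a root of [p], that is, only if [r]
is the modulus of a root. *)
Lemma poly_perturbation p (eps : R) :
  (forall k, 0 <= p`_k) -> p.[1] = 1 -> 0 < eps ->
  exists q, [/\ forall k, 0 <= q`_k, q.[1] = 1, size q = size p,
    forall w, normc w = 1 -> (map_poly (real_complex R) q).[w] != 0 &
    \sum_(k < size p) `|p`_k - q`_k| < eps].
Proof.
move=> p0 p1 eps0.
have pN0 : p != 0 by apply: contra_eq_neq p1 => ->; rewrite horner0 eq_sym oner_eq0.
pose q (r : R) := \poly_(k < size p) (p`_k * r ^+ k / p.[r]).
have qE r k : (q r)`_k = p`_k * r ^+ k / p.[r].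
  rewrite coef_poly; case: ltnP => // pk.
  by rewrite nth_default// !mul0r.
pose P := map_poly (real_complex R) p.
have [rs Prs] := closed_field_poly_normal P.
have near_pos : \forall r \near (1 : R)^', 0 < r.
  by apply: nbhs_dnbhs; apply: lt_nbhsr.
have near_p : \forall r \near (1 : R)^', 0 < p.[r].
  apply: nbhs_dnbhs.
  have : p.[r] @[r --> (1 : R)] --> p.[1] by exact: continuous_horner.
  move=> /cvgr_gt; apply; by rewrite p1.
have near_sum : \forall r \near (1 : R)^',
    \sum_(k < size p) `|p`_k - (q r)`_k| < eps.
  apply: nbhs_dnbhs.
  have cont : \sum_(k < size p) `|p`_k - (q r)`_k| @[r --> (1 : R)] -->
      \sum_(k < size p) `|p`_k - (q 1)`_k|.
    apply: cvg_big; first exact: add_continuous.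
    move=> k _; apply: cvg_norm; apply: cvgB; first exact: cvg_cst.
    under eq_fun do rewrite qE.
    rewrite qE; apply: cvgM.
      by apply: cvgM; [exact: cvg_cst|exact: exprn_continuous].
    apply: cvgV; first by rewrite p1 oner_eq0.
    exact: continuous_horner.
  move/cvgr_lt : cont; apply.
  by rewrite big1// => k _; rewrite qE p1 expr1n mulr1 divr1 subrr normr0.
have near_roots : \forall r \near (1 : R)^', all (fun z => normc z != r) rs.
  (* If [normc z = 1], this holds because the neighbourhood is punctured. *)
  elim: rs {Prs} => [|z rs ih]; first by apply: nearW.
  have nz : \forall r \near (1 : R)^', normc z != r.
    have [->|z1] := eqVneq (normc z) 1.
      by rewrite near_withinE; apply: nearW => r; rewrite eq_sym.
    apply: nbhs_dnbhs.
    have [zlt|zgt|zeq] := ltgtP (normc z) 1.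
    - by near=> r; rewrite lt_eqF//; near: r; exact: lt_nbhsr.
    - by near=> r; rewrite gt_eqF//; near: r; exact: lt_nbhsl.
    - by rewrite zeq eqxx in z1.
  by apply: filterS2 nz ih => r /= -> ->.
have [r [r0 pr0 rsum rroots]] : exists r : R, [/\ 0 < r, 0 < p.[r],
    \sum_(k < size p) `|p`_k - (q r)`_k| < eps &
    all (fun z => normc z != r) rs].
  near (1 : R)^' => r; exists r; split; by near: r.
have sq : size (q r) = size p.
  apply: size_poly_eq; rewrite -lead_coefE mulf_neq0 ?invr_eq0 ?(gt_eqF pr0)//.
  by rewrite mulf_neq0 ?lead_coef_eq0// expf_neq0// gt_eqF.
exists (q r); split => //.
- move=> k; rewrite qE divr_ge0 ?(ltW pr0)// mulr_ge0//.
  by rewrite exprn_ge0// ltW.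
- rewrite horner_poly -[RHS](@divff _ p.[r]) ?gt_eqF// [X in _ = X / _]horner_coef.
  by rewrite mulr_suml; apply: eq_bigr => k _; rewrite expr1n mulr1.
- move=> w w1.
  have -> : (map_poly (real_complex R) (q r)).[w] =
      P.[real_complex R r * w] / real_complex R p.[r].
    rewrite [LHS]horner_coef [X in _ = X / _]horner_coef mulr_suml !size_map_poly sq.
    apply: eq_bigr => k _; rewrite !coef_map qE/= !rmorphM fmorphV rmorphXn exprMn.
    by rewrite /=; ring.
  apply: mulf_neq0; last by rewrite invr_eq0 fmorph_eq0 gt_eqF.
  rewrite Prs hornerZ; apply: mulf_neq0; first by rewrite lead_coef_eq0 map_poly_eq0.
  rewrite -rootE root_prod_XsubC.
  apply/negP => /(allP rroots); rewrite normcM w1 mulr1 normc_real gtr0_norm//.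
  by rewrite eqxx.
Unshelve. all: by end_near. Qed.

End lattice.

(** * Approximation by lattice distributions *)
Section levels.
Variables (R : realType) (mu : probability R R).
Variables (K : R -> nat) (M : nat).
Hypothesis KM : forall y, (K y <= M)%N.
Hypothesis mK : forall k, measurable [set y | K y = k].

Local Notation level k := [set y | K y = k].

Let levelsE (f : nat -> R) y : f (K y) = \sum_(k < M.+1) f k * \1_(level k) y.
Proof.
have KM' : (K y < M.+1)%N by rewrite ltnS.
rewrite (bigD1 (Ordinal KM'))//= indicE mem_set// mulr1 big1 ?addr0// => k /eqP kK.
by rewrite indicE memNset ?mulr0//= => Kk; apply: kK; apply/val_inj.
Qed.

Lemma measurable_levels (f : nat -> R) : measurable_fun setT (fun y => f (K y)).
Proof.
rewrite (_ : (fun y => _) = fun y => \sum_(k < M.+1) f k * \1_(level k) y).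
  by apply: measurable_sum => k; apply: measurable_funM => //; exact: measurable_indic.
by apply/funext => y; exact: levelsE.
Qed.

Lemma Rintegral_levels (f : nat -> R) :
  (\int[mu]_y f (K y))%R = \sum_(k < M.+1) fine (mu (level k)) * f k.
Proof.
rewrite /Rintegral.
under eq_integral do rewrite levelsE -sumEFin.
rewrite integral_sum//; last first.
  move=> k; under eq_fun do rewrite EFinM.
  by apply: integrableZl => //; exact: integrable_indic.
rewrite -sum_fine; last first.
  move=> k _; under eq_integral do rewrite EFinM.
  rewrite integralZl//; last exact: integrable_indic.
  by rewrite integral_indic// setIT fin_numM// fin_num_measure.
apply: eq_bigr => k _; under eq_integral do rewrite EFinM.
rewrite integralZl//; last exact: integrable_indic.
by rewrite integral_indic// setIT fineM ?fin_num_measure//= mulrC.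
Qed.

(** The distribution of a bounded integer-valued function, recorded by its
probability generating polynomial. *)
Lemma levels_poly : exists p : {poly R}, [/\ forall k, 0 <= p`_k, p.[1] = 1 &
  forall f : nat -> R, (\int[mu]_y f (K y))%R = \sum_(k < size p) p`_k * f k].
Proof.
pose p := \poly_(k < M.+1) fine (mu (level k)).
have pE (f : nat -> R) :
    \sum_(k < size p) p`_k * f k = \sum_(k < M.+1) fine (mu (level k)) * f k.
  rewrite (big_ord_widen M.+1 (fun k => p`_k * f k)) ?size_poly// big_mkcond.
  apply: eq_bigr => k _; rewrite coef_poly ltn_ord; case: ltnP => // pk.
  by have := nth_default 0 pk; rewrite coef_poly ltn_ord => ->; rewrite mul0r.
exists p; split.
- by move=> k; rewrite coef_poly; case: ifP => // _; rewrite fine_ge0.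
- rewrite horner_coef (eq_bigr (fun k : 'I_(size p) => p`_k * 1)); last first.
    by move=> k _; rewrite expr1n.
  apply: etrans (pE (fun=> 1)) _.
  apply: etrans (esym (Rintegral_levels (fun=> 1))) _.
  by rewrite /Rintegral integral_cst// [X in (_ * X)%E]probability_setT mule1.
- by move=> f; rewrite Rintegral_levels pE.
Qed.

End levels.

Section discretization.
Variable R : realType.

(** The grid of mesh [1 / N] on [[- N, N]], with [N = n.+1], has its points
numbered from 0 to [2 N ^ 2]; what lies beyond an end is sent to that end. *)
Definition cell (n : nat) (y : R) : nat :=
  minn (Num.truncn (n.+1%:R * (y + n.+1%:R))) (2 * n.+1 ^ 2)%N.

Lemma measurable_cell n k : measurable [set y | cell n y = k].
Proof.
have mL j : measurable [set y | (j < cell n y)%N].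
  rewrite (_ : [set _ | _] = if (j < 2 * n.+1 ^ 2)%N then
      [set y | j.+1%:R <= n.+1%:R * (y + n.+1%:R)] else set0); last first.
    apply/seteqP; split => y /=; rewrite /cell leq_min truncn_gt_nat; case: ifP => //=.
      by rewrite andbT.
    by rewrite andbF.
    by rewrite andbT.
  case: ifP => // _.
  rewrite (_ : [set _ | _] = [set` `[j.+1%:R / n.+1%:R - n.+1%:R, +oo[]).
    exact: measurable_itv.
  apply/seteqP; split => y /=; rewrite in_itv/= andbT;
    by rewrite lerBlDr ler_pdivrMr// mulrC.
case: k => [|k].
  rewrite (_ : [set _ | _] = ~` [set y | (0 < cell n y)%N]).
    exact: measurableC.
  by apply/seteqP; split => y /=; case: (cell n y).
rewrite (_ : [set _ | _] =
    [set y | (k < cell n y)%N] `\` [set y | (k.+1 < cell n y)%N]).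
  exact: measurableD.
apply/seteqP; split => y /=; first by move=> ->; rewrite ltnn ltnSn.
by move=> [k1 /negP]; rewrite -leqNgt => k2; apply/eqP; rewrite eqn_leq k2.
Qed.

Definition grid (n k : nat) : R := k%:R / n.+1%:R - n.+1%:R.

Lemma grid_cell_dist n (y : R) : `|y| < n.+1%:R ->
  `|y - grid n (cell n y)| <= n.+1%:R^-1.
Proof.
rewrite ltr_norml => /andP[yN Ny].
set N : R := n.+1%:R in yN Ny *; have N0 : 0 < N by rewrite ltr0n.
pose g := N * (y + N).
have g0 : 0 <= g by rewrite mulr_ge0 ?(ltW N0)// -lerBlDr sub0r ltW.
have gM : g <= (2 * n.+1 ^ 2)%N%:R.
  rewrite natrM natrX -/N (_ : 2%:R * N ^+ 2 = N * (2 * N)); last by ring.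
  by rewrite ler_pM2l// mulr_natl mulr2n lerD2r ltW.
have /andP[Kg gK] := truncn_itv g0.
have cellE : cell n y = Num.truncn g.
  by apply/minn_idPl; rewrite -(ler_nat R) (le_trans Kg).
have -> : y - grid n (cell n y) = (g - (Num.truncn g)%:R) / N.
  by rewrite cellE /grid -/N /g; field; rewrite gt_eqF.
rewrite ger0_norm ?divr_ge0 ?subr_ge0 ?(ltW N0)//.
rewrite -[leRHS]mul1r ler_wpM2r ?invr_ge0 ?(ltW N0)//.
by rewrite lerBlDr addrC natr1 ltW.
Qed.

(** For large [n] the point [y] lies inside the range of the grid, and it is
rounded to a grid point at distance at most the mesh. *)
Lemma grid_cell (y : R) : grid n (cell n y) @[n --> \oo] --> y.
Proof.
apply/cvgrPdist_le => e e0; near=> n.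
apply: (@le_trans _ _ (n.+1%:R^-1)).
  apply: grid_cell_dist.
  apply: (@le_lt_trans _ _ (Num.truncn `|y|).+1%:R).
    exact: ltW (truncnS_gt _).
  rewrite ltr_nat ltnS; near: n; exact: nbhs_infty_gt.
near: n.
have /cvgrPdist_le/(_ _ e0) := @cvg_harmonic R.
by apply: filterS => n /=; rewrite sub0r normrN ger0_norm.
Unshelve. all: by end_near. Qed.

End discretization.
Arguments grid {R}.

Section main.
Variables (R : realType) (c : R -> R) (hc : representation_function c).

Lemma lattice_qid (q : {poly R}) (h a : R) (q0 : forall k, 0 <= q`_k)
    (q1 : q.[1] = 1) :
  h != 0 -> (forall w, normc w = 1 -> (map_poly (real_complex R) q).[w] != 0) ->
  qid_finite_no_gauss c (lattice_probability (fun k => k%:R * h - a) q0 q1).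
Proof.
move=> h0 qnz; apply: qid_signed_compound_poisson => //.
have -> : characteristic_function
      (lattice_probability (fun k => k%:R * h - a) q0 q1) =
    (fun t => expi (- a * t) * (map_poly (real_complex R) q).[expi (h * t)]).
  by apply/funext => t; exact: characteristic_lattice.
apply: signed_compound_poisson_shift.
exact: (@signed_compound_poisson_dilate _
  (fun t => (map_poly (real_complex R) q).[expi t]) h h0
  (signed_compound_poisson_horner q1 qnz)).
Qed.

(** The perturbed polynomial is chosen so that its coefficients differ from
those of the distribution of [grid n (cell n y)] by less than [1 / n.+1] in
total. *)
Lemma lattice_approximation (mu : probability R R) (n : nat) :
  exists nu : probability R R, qid_finite_no_gauss c nu /\
    forall (f : R -> R) (M : R),
    measurable_fun setT f -> (forall y, `|f y| <= M) ->
    `|(\int[nu]_y f y)%R - (\int[mu]_y f (grid n (cell n y)))%R| <= M / n.+1%:R.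
Proof.
have [p [p0 p1 pE]] := levels_poly mu (fun y => geq_minr _ _) (measurable_cell n).
have n0 : 0 < n.+1%:R^-1 :> R by rewrite invr_gt0.
have [q [q0 q1 sq qnz pq]] := poly_perturbation p0 p1 n0.
have h0 : n.+1%:R^-1 != 0 :> R by rewrite gt_eqF.
exists (lattice_probability (grid n) q0 q1); split; first exact: lattice_qid.
move=> f M mf fM; rewrite Rintegral_lattice// (pE (fun k => f (grid n k))) sq -sumrB.
apply: (le_trans (ler_norm_sum _ _ _)).
apply: (@le_trans _ _ (\sum_(k < size p) M * `|p`_k - q`_k|)).
  apply: ler_sum => k _; rewrite -mulrBl normrM mulrC distrC.
  by rewrite ler_wpM2r.
rewrite -mulr_sumr ler_wpM2l ?(ltW pq)//.
exact: le_trans (normr_ge0 _) (fM 0).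
Qed.

End main.

(** The approximants differ on bounded functions by [O(1 / n.+1)] from the
rounded distributions, and these converge weakly by dominated convergence since the
rounding converges pointwise to the identity. *)
Theorem theorem4p1 (R : realType) (c : R -> R)
  (hc : representation_function c) :
  weakly_dense (qid_finite_no_gauss c).
Proof.
move=> mu.
have [nu_ nuP] := choice (lattice_approximation hc mu).
exists nu_; first by move=> n; exact: (nuP n).1.
move=> f cf [M0 [_ bM]].
pose M := M0 + 1.
have fM y : `|f y| <= M by apply: bM => //; rewrite ltrDl.
have mf : measurable_fun setT f by exact: continuous_measurable_fun.
pose F n (y : R) := f (grid n (cell n y)).
have mF n : measurable_fun setT (F n).
  exact: (measurable_levels (fun y => geq_minr _ _) (measurable_cell n)
    (fun k => f (grid n k))).
have cvF : (\int[mu]_y F n y)%R @[n --> \oo] --> (\int[mu]_y f y)%R.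
  have := @dominated_convergence _ _ _ mu setT measurableT
    (fun n y => (F n y)%:E) (fun y => (f y)%:E) (cst M%:E).
  case.
  - by move=> n; apply/measurable_EFinP.
  - exact/measurable_EFinP.
  - apply/aeW => y _; apply: cvg_EFin; first by apply: nearW.
    have : (f \o (fun n => grid n (cell n y))) @ \oo --> f y.
      apply: continuous_cvg; [exact: cf y|exact: grid_cell].
    exact.
  - exact: finite_measure_integrable_cst.
  - by apply/aeW => y n _; rewrite /= lee_fin; exact: fM.
  - move=> intf _ cvi; rewrite /Rintegral.
    apply: fine_cvg; rewrite fineK//. 
    exact: integrable_fin_num.
rewrite -[X in _ --> X]add0r.
rewrite (_ : (fun n => _) = (fun n => ((\int[nu_ n]_y f y)%R - (\int[mu]_y F n y)%R)
   + (\int[mu]_y F n y)%R)); last by apply/funext => n; rewrite subrK.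
apply: cvgD => //.
apply/cvgrPdist_le => e e0; near=> n; rewrite sub0r normrN.
apply: le_trans ((nuP n).2 f M mf fM) _.
near: n.
have : M * harmonic n @[n --> \oo] --> M * 0.
  by apply: cvgM; [exact: cvg_cst|exact: cvg_harmonic].
rewrite mulr0.
move=> /cvgrPdist_le/(_ _ e0); apply: filterS => n /=; rewrite sub0r normrN.
exact: le_trans (ler_norm _).
Unshelve. all: by end_near. Qed.
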